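(* If a connected twin-free graph $G$ of order at least $4$ is in $\mathrm{ORTH}[3,2,3]$, then $G$ is (isomorphic to) the line graph of a planar graph.
   Context: Graphs are finite and simple. Two distinct vertices $u,v$ are twins if $N[u]=N[v]$; a graph is twin-free if it has no twins. For positive integers $h,s,t$, $\mathrm{ORTH}[h,s,t]$ is the class of graphs $G$ having a pair $(T,\mathcal{S})$, where $T$ is a tree of maximum degree at most $h$ and $\mathcal{S}=(S_u)_{u\in V(G)}$ is a collection of subtrees of $T$ of maximum degree at most $s$, one per vertex of $G$, such that every leaf of each $S_u$ is a leaf of $T$, and for all distinct $u,v\in V(G)$ the following are equivalent: (i) $u,v$ adjacent; (ii) $S_u,S_v$ have at least $t$ common vertices; (iii) $S_u,S_v$ share a leaf of $T$. *)

(* Defs.v *)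
From HB Require Import structures.
From mathcomp Require Import all_boot all_order all_algebra.
From mathcomp Require Import all_classical reals topology normedtype.

Set Implicit Arguments.
Unset Strict Implicit.
Unset Printing Implicit Defensive.

Import Order.TTheory GRing.Theory Num.Theory.
Import numFieldNormedType.Exports.

Record sgraph := SGraph {
  vertex :> finType;
  adj : rel vertex;
  adj_sym : symmetric adj;
  adj_irr : irreflexive adj
}.

Definition isomorphic (G H : sgraph) : Prop :=
  exists2 f : G -> H, bijective f & forall u v, adj (f u) (f v) = adj u v.

Definition degree (G : sgraph) (u : G) : nat := #|[pred v | adj u v]|.

Definition maxdeg_le (G : sgraph) (k : nat) : Prop :=
  forall u : G, degree u <= k.

Definition leaf (G : sgraph) (u : G) : bool := degree u == 1.

Definition connected_graph (G : sgraph) : Prop :=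
  0 < #|G| /\ forall u v : G, connect (@adj G) u v.

(* A [ucycle] of length at most 2 is a vertex or an edge run back and forth. *)
Definition acyclic (G : sgraph) : Prop :=
  forall c : seq G, 2 < size c -> ~ ucycle (@adj G) c.

Definition tree (G : sgraph) : Prop := connected_graph G /\ acyclic G.

Definition closed_nbhd (G : sgraph) (u : G) : {set G} :=
  [set v | (v == u) || adj u v].

Definition twins (G : sgraph) (u v : G) : Prop :=
  u <> v /\ closed_nbhd u = closed_nbhd v.

Definition twin_free (G : sgraph) : Prop := forall u v : G, ~ twins u v.

Section Induced.
Variables (G : sgraph) (A : {set G}).

Definition induced_adj (u v : {u : G | u \in A}) : bool :=
  adj (val u) (val v).

Lemma induced_adj_sym : symmetric induced_adj.
Proof. by move=> u v; apply: adj_sym. Qed.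

Lemma induced_adj_irr : irreflexive induced_adj.
Proof. by move=> u; apply: adj_irr. Qed.

Definition induced : sgraph := SGraph induced_adj_sym induced_adj_irr.

End Induced.

(* A subtree of a tree is given by its vertex set: any connected subgraph of
   a tree is induced. *)
Definition orth_representation (h s t : nat) (G T : sgraph)
    (S : G -> {set T}) : Prop :=
  [/\ tree T, maxdeg_le T h,
      forall u, tree (induced (S u)) /\ maxdeg_le (induced (S u)) s,
      forall u (x : induced (S u)), leaf x -> leaf (val x) &
      forall u v : G, u <> v ->
        (adj u v <-> t <= #|S u :&: S v|) /\
        (adj u v <-> exists2 x : T, leaf x & x \in S u :&: S v)].

Definition ORTH (h s t : nat) (G : sgraph) : Prop :=
  exists (T : sgraph) (S : G -> {set T}), orth_representation h s t S.

Definition edges (G : sgraph) : {set {set G}} :=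
  [set E | [exists u, exists v, adj u v && (E == [set u; v])]].

Section LineGraph.
Variable G : sgraph.

Definition line_adj (E F : {E : {set G} | E \in edges G}) : bool :=
  (E != F) && ~~ [disjoint val E & val F].

Lemma line_adj_sym : symmetric line_adj.
Proof. by move=> E F; rewrite /line_adj eq_sym disjoint_sym. Qed.

Lemma line_adj_irr : irreflexive line_adj.
Proof. by move=> E; rewrite /line_adj eqxx. Qed.

Definition line_graph : sgraph := SGraph line_adj_sym line_adj_irr.

End LineGraph.

Section Planarity.
Local Open Scope ring_scope.
Local Open Scope classical_set_scope.
Variable R : realType.

Definition arc_between (p q : R * R) (A : set (R * R)) : Prop :=
  exists f : R -> R * R,
    [/\ {within `[0, 1], continuous f},
        {in `[0, 1] &, injective f},
        f 0 = p, f 1 = q & A = f @` `[0, 1]].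

Definition plane_drawing (G : sgraph) (pos : G -> R * R)
    (arc : {set G} -> set (R * R)) : Prop :=
  [/\ injective pos,
      forall u v, adj u v ->
        arc_between (pos u) (pos v) (arc [set u; v]%SET),
      forall E w, E \in edges G -> arc E (pos w) -> w \in E &
      forall E F, E \in edges G -> F \in edges G -> E <> F ->
        forall p, arc E p -> arc F p ->
          exists2 w, (w \in E) && (w \in F) & p = pos w].

Definition planar (G : sgraph) : Prop :=
  exists (pos : G -> R * R) (arc : {set G} -> set (R * R)),
    plane_drawing pos arc.

End Planarity.

(* Main.v *)
(** Every [S u] is a path of [T] joining two leaves of [T], and twin-freeness
    makes [u] determined by these two leaves; so [G] is the line graph of the
    graph [H] on the leaves of [T] whose edges are the pairs of ends.  At an
    inner node of [T], two paths running between the same two branches share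
    three vertices, hence a leaf: the edges of [H] between two branches at a
    node pairwise meet and so form a star.  Splitting [T] at a node along the
    centre [d] of such a star, and collapsing everything outside of a branch to
    one or two vertices, shows that [H] is a subgraph of an iterated 2-clique-sum
    of copies of K2, K3 and K4, which can be grown from any of its edges.  Such a
    graph has a straight-line drawing: each edge lies on an empty triangle, and
    new vertices are stacked at centroids of empty triangles. *)

Require Import Defs.
From HB Require Import structures.
From mathcomp Require Import all_boot all_order all_algebra.
From mathcomp Require Import zify ring lra.

Set Implicit Arguments.
Unset Strict Implicit.
Unset Printing Implicit Defensive.

(** The three parameters enter separately. Subtrees of maximum degree 2 are paths; a host tree of
    maximum degree 3 has at most two onward branches at a node; and 3 counts a node with its two
    neighbours, which two paths crossing between the same branches must share. The obstacle is that
    collapsing the outside to one vertex does not give an induction that closes: at [Nd l r] the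
    outside of [r] consists of [labels l] and [O], which have to become the distinct vertices [d]
    and [z]. Hence the stronger claim with two outside vertices and an arbitrary splitting [chi]. No
    third vertex is ever needed: by the star condition, if a half sees both classes of its outside,
    then it sees them from a single label. When this happens in both halves, these two labels and
    the two outside vertices can be pairwise adjacent, which is where K4 comes from. *)

Section CliqueSums.
Variable L : finType.
Implicit Types (V W X Y Z O : {set L}) (E F : rel L).

(** * Graphs grown by gluing small cliques along edges *)

Definition clique V : rel L := fun x y => [&& x \in V, y \in V & x != y].

(** A step glues K2, K3 or K4 along the present edge [a b]. Edges may be deleted at any time, so
    only inclusions of edge sets have to be tracked. *)
Inductive ext V0 F0 : {set L} -> rel L -> Prop :=
| ext_refl : ext V0 F0 V0 F0
| ext_clique V F a b W : ext V0 F0 V F -> a \in V -> b \in V -> F a b ->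
    [disjoint W & V] -> #|W| <= 2 ->
    ext V0 F0 (V :|: W) (relU F (clique (a |: (b |: W))))
| ext_sub V F F' : ext V0 F0 V F -> subrel F' F -> ext V0 F0 V F'.

(** Every edge must serve as a seed, because a summand is attached at whichever edge it shares with
    the part already built. *)
Definition good V F : Prop :=
  [/\ symmetric F, forall x y, F x y -> [/\ x \in V, y \in V & x != y] &
      forall a b, F a b -> ext [set a; b] (clique [set a; b]) V F].

Lemma ext_subset V0 F0 V F : ext V0 F0 V F -> V0 \subset V.
Proof.
elim=> {V F}[|V F a b W _ IH _ _ _ _ _|//]; first exact: subxx.
exact: subset_trans IH (subsetUl _ _).
Qed.

(** The steps leading from [X] to [Y] are replayed on top of [Z]; the last premise keeps the
    vertices that they add outside [Z]. *)
Lemma ext_trans V0 F0 X FX Y FY Z FZ :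
  ext X FX Y FY -> ext V0 F0 Z FZ -> X \subset Z -> subrel FX FZ ->
  Z :&: Y \subset X -> ext V0 F0 (Z :|: Y) (relU FZ FY).
Proof.
move=> eXY eZ sXZ sF; elim: eXY => {Y FY}
  [|Y FY a b W eXY IH aY bY Fab dWY cW|Y FY F' _ IH sF'] sZY.
- have /setUidPl -> := sXZ; apply: ext_sub eZ _ => x y /orP[]//; exact: sF.
- have sZY' : Z :&: Y \subset X.
    by apply: subset_trans sZY; rewrite setIS // subsetUl.
  rewrite setUA.
  apply: (@ext_sub _ _ _ (relU (relU FZ FY) (clique (a |: (b |: W))))); last first.
    by move=> x y /=; rewrite orbA.
  apply: ext_clique => //; first exact: IH.
  + by rewrite inE aY orbT.
  + by rewrite inE bY orbT.
  + by rewrite /= Fab orbT.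
  rewrite disjoint_subset; apply/subsetP => w wW; rewrite !inE negb_or.
  have wY : w \notin Y by rewrite (disjointFr dWY).
  rewrite wY andbT; apply: contra wY => wZ.
  have /(subsetP (ext_subset eXY)) // : w \in X.
  by apply: (subsetP sZY); rewrite !inE wZ wW orbT.
- apply: ext_sub (IH sZY) _ => x y /= /orP[->//|/sF' ->]; exact: orbT.
Qed.

(** The summand containing the seed is grown completely; it then contains [c d], from which the
    other summand is grown. *)
Lemma good_sum V1 F1 V2 F2 c d : good V1 F1 -> good V2 F2 ->
  V1 :&: V2 = [set c; d] -> F1 c d -> F2 c d ->
  good (V1 :|: V2) (relU F1 F2).
Proof.
move=> [s1 v1 e1] [s2 v2 e2] VI F1cd F2cd.
have sub F : symmetric F -> F c d -> subrel (clique [set c; d]) F.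
  move=> sF Fcd x y; rewrite /clique !inE.
  by case/and3P=> /orP[]/eqP-> /orP[]/eqP->; rewrite ?eqxx // sF.
split=> [x y|x y|a b] /=; first by rewrite s1 s2.
  by case/orP=> [/v1|/v2] [xV yV ne]; rewrite !inE xV yV ?orbT.
case/orP=> [/e1|/e2] e.
  by apply: (ext_trans (e2 _ _ F2cd) e); [rewrite -VI subsetIl|exact: sub|rewrite VI].
rewrite (setUC V1); apply: (@ext_sub _ _ _ (relU F2 F1)); last first.
  by move=> x y /=; rewrite orbC.
by apply: (ext_trans (e1 _ _ F1cd) e);
  [rewrite -VI subsetIr|exact: sub|rewrite setIC VI].
Qed.

Lemma leq_cards1U x V n : #|V| <= n -> #|x |: V| <= n.+1.
Proof. by move=> h; rewrite cardsU1; case: (_ \notin _); rewrite //= ltnW. Qed.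

Lemma leq_cardsU1 x V n : #|V| <= n -> #|V :|: [set x]| <= n.+1.
Proof. by rewrite setUC; apply: leq_cards1U. Qed.

Lemma good_clique V : #|V| <= 4 -> good V (clique V).
Proof.
move=> cV; split=> [x y|x y /and3P[]//|a b /and3P[aV bV ab]].
  by rewrite /clique eq_sym andbCA.
have sab : [set a; b] \subset V by rewrite subUset !sub1set aV.
have VE : [set a; b] :|: (V :\: [set a; b]) = V.
  by rewrite -{1}(setIidPr sab) setID.
rewrite -{1}VE.
apply: ext_sub (ext_clique (ext_refl _ _) (a := a) (b := b) _ _ _ _ _) _.
- by rewrite !inE eqxx.
- by rewrite !inE eqxx orbT.
- by rewrite /clique !inE !eqxx orbT.
- by rewrite disjoint_sym disjoints_subset; apply/subsetP=> x; rewrite !inE => ->.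
- rewrite cardsD (setIidPr sab) cards2 ab; lia.
- by move=> x y; rewrite /= setUA VE orbC => ->.
Qed.

(** * Binary trees with star conditions, and good graphs representing them *)

Inductive btree := Lf of L | Nd of btree & btree.

Fixpoint labels t : {set L} :=
  match t with Lf a => [set a] | Nd l r => labels l :|: labels r end.

Definition star E X Y : Prop := forall a a' b b',
  a \in X -> a' \in X -> b \in Y -> b' \in Y -> E a b -> E a' b' ->
  a = a' \/ b = b'.

(* [O] stands for the labels outside of the subtree [t]. *)
Fixpoint starry E t (O : {set L}) : Prop :=
  match t with
  | Lf a => a \notin O
  | Nd l r => [/\ star E (labels l) (labels r), star E (labels l) O,
      star E (labels r) O, starry E l (labels r :|: O) &
      starry E r (labels l :|: O)]
  end.

Lemma starryC E l r O : symmetric E -> starry E (Nd l r) O ->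
  starry E (Nd r l) O.
Proof.
move=> sE [] S Sl Sr Tl Tr; split=> // a a' b b' ar ar' bl bl' Eab Eab'.
by case: (S b b' a a') => //; [rewrite sE|rewrite sE|right|left].
Qed.

Lemma starry_notin E t O : starry E t O -> forall x, x \in labels t -> x \notin O.
Proof.
elim: t O => [a|l IHl r IHr] O /=; first by move=> aO x; rewrite inE => /eqP->.
case=> _ _ _ /IHl hl /IHr hr x; rewrite inE.
by case/orP=> [/hl|/hr]; rewrite inE negb_or => /andP[].
Qed.

Lemma starry_disjoint E l r O : starry E (Nd l r) O ->
  forall x, x \in labels l -> x \in labels r -> False.
Proof.
by case=> _ _ _ /starry_notin h _ x /h; rewrite inE negb_or => /andP[/negP].
Qed.

(* The labels of [O] are merged into the single vertex [z]. *)
Definition repr1 E t O z : Prop := exists F,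
  [/\ good (z |: labels t) F,
    forall x y, x \in labels t -> y \in labels t -> x != y -> E x y -> F x y,
    forall x o, x \in labels t -> o \in O -> E x o -> F x z &
    exists2 d, d \in labels t & F z d].

(* The labels of [O] are merged into [z1] or [z2], according to [chi]. *)
Definition repr2 E t O (chi : pred L) z1 z2 : Prop := exists F,
  [/\ good (z1 |: (z2 |: labels t)) F,
    forall x y, x \in labels t -> y \in labels t -> x != y -> E x y -> F x y,
    forall x o, x \in labels t -> o \in O -> E x o ->
      F x (if chi o then z1 else z2) &
    F z1 z2].

Definition represents1 t : Prop := forall E O z, symmetric E -> starry E t O ->
  z \notin labels t -> repr1 E t O z.

Definition represents2 t : Prop := forall E O (chi : pred L) z1 z2,
  symmetric E -> starry E t O ->
  z1 \notin labels t -> z2 \notin labels t -> z1 != z2 -> repr2 E t O chi z1 z2.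

Definition centred E X Y d := forall x y, x \in X -> y \in Y -> E x y -> x = d.

(** An edge [x1 y1] with [x1 != x0] forces [y1 = y0]. Any edge then agrees at one end with [x0 y0]
    and with [x1 y0], so it ends at [y0]. *)
Lemma star_centre E X Y x0 y0 : star E X Y -> x0 \in X -> y0 \in Y -> E x0 y0 ->
  symmetric E -> centred E X Y x0 \/ centred E Y X y0.
Proof.
move=> S x0X y0Y E0 sE.
case: (boolP [exists x in X, exists y in Y, E x y && (x != x0)]); last first.
  move=> /existsP N; left=> x y xX yY Exy; apply/eqP/negP=> ne; apply: N.
  by exists x; rewrite xX; apply/existsP; exists y; rewrite yY Exy; apply/negP.
move=> /existsP[x1 /andP[x1X /existsP[y1 /andP[y1Y /andP[E1 ne]]]]].
have Ey : y1 = y0 by case: (S _ _ _ _ x1X x0X y1Y y0Y E1 E0) ne => // ->; rewrite eqxx.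
subst y1; right=> y x yY xX; rewrite sE => Exy.
case: (S _ _ _ _ x0X xX y0Y yY E0 Exy) => // ex.
subst x; case: (S _ _ _ _ x1X x0X y0Y yY E1 Exy) => // ex.
by rewrite ex eqxx in ne.
Qed.

Definition lcentred E l r : Prop :=
  (exists2 x, x \in labels l /\ (exists2 y, y \in labels r & E x y) &
     centred E (labels l) (labels r) x) \/
  (forall x y, x \in labels l -> y \in labels r -> ~~ E x y).

Lemma lcentredP E l r O : symmetric E -> starry E (Nd l r) O ->
  lcentred E l r \/ lcentred E r l.
Proof.
move=> sE [S _ _ _ _].
case: (boolP [exists x in labels l, exists y in labels r, E x y]); last first.
  move=> /existsP N; left; right=> x y xX yY; apply/negP=> Exy; apply: N.
  by exists x; rewrite xX; apply/existsP; exists y; rewrite yY.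
move=> /existsP[x /andP[xX /existsP[y /andP[yY Exy]]]].
case: (star_centre S xX yY Exy sE) => c.
  by left; left; exists x => //; split=> //; exists y.
by right; left; exists y => //; split=> //; exists x; rewrite // sE.
Qed.

(** A genuine centre is adjacent to [z], since its star edges leave [l] and are merged into [z]. If
    the star is empty, any neighbour of [z] can stand in; this is why [repr1] demands one. *)
Lemma lcentred_pick E l r F z d' : lcentred E l r -> symmetric F ->
  (forall x o, x \in labels l -> o \in labels r -> E x o -> F x z) ->
  d' \in labels l -> F z d' ->
  exists d, [/\ d \in labels l, F z d & centred E (labels l) (labels r) d].
Proof.
move=> [[x [xl [y yr Exy]] c] sF h _ _|N _ _ d'l Fd].
  by exists x; split=> //; rewrite sF (h x y).
by exists d'; split=> // x y xl yr Exy; move: (N x y xl yr); rewrite Exy.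
Qed.

(* 2-sum along the edge [z d], where [d] is the centre of the star between
   [l] and [r]. *)
Lemma represents1_Nd l r E O z : represents1 l -> represents2 r ->
  symmetric E -> starry E (Nd l r) O -> z \notin labels (Nd l r) ->
  lcentred E l r -> repr1 E (Nd l r) O z.
Proof.
move=> P1 P2 sE st; rewrite /= inE negb_or => /andP[zl zr] lc.
have dj := starry_disjoint st; case: (st) => _ _ _ stl str.
have [F1 [g1 c1 o1 [d' d'l Fd']]] := P1 E _ z sE stl zl.
have sF1 : symmetric F1 by case: g1.
have [|d [dl Fd cd]] := lcentred_pick lc sF1 _ d'l Fd'.
  by move=> x o xl orr; apply: o1; rewrite ?inE ?orr.
have dr : d \notin labels r by apply/negP => /(dj _ dl).
have dz : d != z by apply: contraNneq zl => <-.
(* Outside [r], the labels of [l] collapse to [d], the only one of them with neighbours in [r], and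
   [O] collapses to [z]. *)
have [F2 [g2 c2 o2 Fdz]] := P2 E _ (mem (labels l)) d z sE str dr zr dz.
have sF2 : symmetric F2 by case: g2.
have lr x y : x \in labels l -> y \in labels r -> E x y -> F2 x y.
  move=> xl yr Exy; rewrite (cd x y xl yr Exy) sF2.
  have := o2 y x yr; rewrite inE xl /= sE => /(_ isT Exy).
  by rewrite xl.
exists (relU F1 F2); split.
- have -> : z |: (labels l :|: labels r) = (z |: labels l) :|: (d |: (z |: labels r)).
    apply/setP=> x; rewrite !inE.
    by case: (x =P d) => [->|]; rewrite ?dl ?orbT //=; do !case: (_ \in _); rewrite ?orbT ?orbF // orbb.
  apply: (good_sum g1 g2 (c := z) (d := d)) => //; last by rewrite sF2.
  apply/setP=> x; rewrite !inE.
  case: (x =P z) => [_|_] /=; first by rewrite orbT.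
  case: (x =P d) => [->|_] /=; first by rewrite dl.
  by apply/negP=> /andP[/dj].
- move=> x y; rewrite !inE => /orP[xl|xr] /orP[yl|yr] ne Exy /=.
  + by rewrite c1.
  + by rewrite lr ?orbT.
  + by rewrite sF2 lr ?orbT // sE.
  + by rewrite c2 ?orbT.
- move=> x o; rewrite !inE => /orP[xl|xr] oO Exo /=.
    by rewrite (o1 x o) // inE oO orbT.
  have := o2 x o xr; rewrite inE oO orbT /= => /(_ isT Exo).
  by case: (boolP (o \in labels l)) => [/(starry_notin stl)|_ ->]; rewrite ?orbT // inE oO orbT.
- by exists d; rewrite ?inE ?dl //= Fd.
Qed.

Definition exposed E O (chi : pred L) x := [exists o in O, chi o && E x o].

Lemma exposedP E O (chi : pred L) x :
  reflect (exists o, [/\ o \in O, chi o & E x o]) (exposed E O chi x).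
Proof.
apply: (iffP existsP) => [[o /and3P[]]|[o [a b c]]]; exists o => //.
by rewrite a b c.
Qed.

Lemma repr2C E t O (chi : pred L) z1 z2 : repr2 E t O (predC chi) z2 z1 ->
  repr2 E t O chi z1 z2.
Proof.
move=> [F [g c o f]]; exists F; split=> //; first by rewrite setUCA.
  by move=> x p xt pO Exp; have := o x p xt pO Exp; rewrite /= if_neg.
by case: g => ->.
Qed.

Lemma repr2_NdC E l r O chi z1 z2 : repr2 E (Nd l r) O chi z1 z2 ->
  repr2 E (Nd r l) O chi z1 z2.
Proof. by rewrite /repr2 /= (setUC (labels l)). Qed.

(* 2-sum of [l] with [z1], the triangle [z1 d z2], and [r] with [d] and [z2]. *)
Lemma repr2_separate l r E O (chi : pred L) z1 z2 :
  represents1 l -> represents2 r ->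
  symmetric E -> starry E (Nd l r) O ->
  z1 \notin labels (Nd l r) -> z2 \notin labels (Nd l r) -> z1 != z2 ->
  (forall x, x \in labels l -> ~~ exposed E O (predC chi) x) ->
  (forall x, x \in labels r -> ~~ exposed E O chi x) ->
  lcentred E l r -> repr2 E (Nd l r) O chi z1 z2.
Proof.
move=> P1 P2 sE st; rewrite /= !inE !negb_or => /andP[z1l z1r] /andP[z2l z2r].
move=> nez el er lc.
have dj := starry_disjoint st; case: (st) => _ _ _ stl str.
have [F1 [g1 c1 o1 [d' d'l Fd']]] := P1 E _ z1 sE stl z1l.
have sF1 : symmetric F1 by case: g1.
have [|d [dl Fd cd]] := lcentred_pick lc sF1 _ d'l Fd'.
  by move=> x o xl orr; apply: o1; rewrite ?inE ?orr.
have dr : d \notin labels r by apply/negP => /(dj _ dl).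
have dz1 : d != z1 by apply: contraNneq z1l => <-.
have dz2 : d != z2 by apply: contraNneq z2l => <-.
have [F2 [g2 c2 o2 Fdz]] := P2 E _ (mem (labels l)) d z2 sE str dr z2r dz2.
have sF2 : symmetric F2 by case: g2.
have lr x y : x \in labels l -> y \in labels r -> E x y -> F2 x y.
  move=> xl yr Exy; rewrite (cd x y xl yr Exy) sF2.
  have := o2 y x yr; rewrite inE xl /= sE => /(_ isT Exy).
  by rewrite xl.
(* The triangle supplies the required edge [z1 z2]; it meets [F1] in [z1 d] and [F2] in [d z2]. *)
have g3 : good [set z1; d; z2] (clique [set z1; d; z2]).
  by apply: good_clique; do ?[apply: leq_cardsU1|apply: leq_cards1U]; rewrite ?cards1.
have g13 := good_sum g1 g3 (c := z1) (d := d).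
have {}g13 : good ((z1 |: labels l) :|: [set z1; d; z2]) (relU F1 (clique [set z1; d; z2])).
  apply: g13; rewrite ?Fd ?/clique ?inE ?eqxx ?orbT ?(eq_sym z1) ?dz1 //.
  apply/setP=> x; rewrite !inE.
  case: (x =P z1) => //= _; case: (x =P d) => [->|_] /=; first by rewrite dl.
  by apply/negP=> /andP[xl /eqP xz]; rewrite xz (negPf z2l) in xl.
exists (relU (relU F1 (clique [set z1; d; z2])) F2); split.
- have -> : z1 |: (z2 |: (labels l :|: labels r)) =
    ((z1 |: labels l) :|: [set z1; d; z2]) :|: (d |: (z2 |: labels r)).
    apply/setP=> x; rewrite !inE.
    case: (x =P d) => [->|_] /=; rewrite ?dl ?orbT //=.
    by case: (x == z1); case: (x == z2); case: (_ \in _); case: (_ \in _).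
  apply: (good_sum g13 g2 (c := d) (d := z2)) => //=; last first.
    by rewrite /clique !inE !eqxx dz2 ?orbT.
  apply/setP=> x; rewrite !inE.
  case: (x =P d) => [->|_] /=; first by rewrite dl orbT.
  case: (x =P z2) => [->|_] /=; first by rewrite ?orbT.
  rewrite !orbF; apply/negP; case: (x =P z1) => [->|_] /=; first by rewrite (negPf z1r).
  by rewrite orbF => /andP[/dj].
- move=> x y; rewrite !inE => /orP[xl|xr] /orP[yl|yr] ne Exy /=.
  + by rewrite c1.
  + by rewrite lr ?orbT.
  + by rewrite sF2 lr ?orbT // sE.
  + by rewrite c2 ?orbT.
- move=> x o; rewrite !inE => /orP[xl|xr] oO Exo /=.
    case: ifP => [_|/negbT co]; first by rewrite (o1 x o) // inE oO orbT.
    by case/exposedP: (el x xl); exists o.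
  case: ifP => [co|_]; first by case/exposedP: (er x xr); exists o.
  have := o2 x o xr; rewrite inE oO orbT /= => /(_ isT Exo).
  by case: (boolP (o \in labels l)) => [/(starry_notin stl)|_ ->]; rewrite ?orbT // inE oO orbT.
- by rewrite /= /clique !inE !eqxx nez ?orbT.
Qed.

(** Merging all of [O] into [z1] is wrong only for edges into the class of [z2]. These start at one
    label [d], so a triangle on [z1], [d], [z2] restores them. If there are none, [d] is just some
    neighbour of [z1]. *)
Lemma repr2_single t E O (chi : pred L) z1 z2 b : represents1 t ->
  symmetric E -> starry E t O ->
  z1 \notin labels t -> z2 \notin labels t -> z1 != z2 ->
  (forall x, x \in labels t -> exposed E O (predC chi) x -> x = b) ->
  repr2 E t O chi z1 z2.
Proof.
move=> P1 sE st z1t z2t nez eb.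
have [F1 [g1 c1 o1 [d' d't Fd']]] := P1 E _ z1 sE st z1t.
have sF1 : symmetric F1 by case: g1.
have [d [dt Fd cd]] : exists d, [/\ d \in labels t, F1 z1 d &
    forall x, x \in labels t -> exposed E O (predC chi) x -> x = d].
  case: (boolP [exists x in labels t, exposed E O (predC chi) x]).
    move=> /existsP[x /andP[xt xe]]; exists x; split=> //.
      by case/exposedP: xe => o [oO _ Exo]; rewrite sF1 (o1 x o).
    by move=> y yt ye; rewrite (eb x) // (eb y).
  move=> /existsP N; exists d'; split=> // x xt xe; case: N.
  by exists x; rewrite xt.
have dz1 : z1 != d by apply: contraNneq z1t => ->.
have dz2 : d != z2 by apply: contraNneq z2t => <-.
have g3 : good [set z1; d; z2] (clique [set z1; d; z2]).
  by apply: good_clique; do ?[apply: leq_cardsU1|apply: leq_cards1U]; rewrite ?cards1.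
exists (relU F1 (clique [set z1; d; z2])); split.
- have -> : z1 |: (z2 |: labels t) = (z1 |: labels t) :|: [set z1; d; z2].
    apply/setP=> x; rewrite !inE.
    case: (x =P d) => [->|_] /=; rewrite ?dt ?orbT //=.
    by case: (x == z1); case: (x == z2); case: (_ \in _).
  apply: (good_sum g1 g3 (c := z1) (d := d)) => //; last first.
    by rewrite /clique !inE !eqxx dz1 ?orbT.
  apply/setP=> x; rewrite !inE.
  case: (x =P z1) => //= _; case: (x =P d) => [->|_] /=; first by rewrite dt.
  by apply/negP=> /andP[xl /eqP xz]; rewrite xz (negPf z2t) in xl.
- by move=> x y xt yt ne Exy; rewrite /= c1.
- move=> x o xt oO Exo /=; case: ifP => [_|/negbT co].
    by rewrite (o1 x o).
  rewrite (cd x) //; last by apply/exposedP; exists o.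
  by rewrite /clique !inE !eqxx dz2 ?orbT.
- by rewrite /= /clique !inE !eqxx nez ?orbT.
Qed.

(* [l] with [b2] and [r] with [d] are summed along [d b2], then K4 on
   [b1 b2 z1 z2] is glued along [b1 b2]. *)
Lemma repr2_K4 l r E O (chi : pred L) z1 z2 b1 b2 :
  represents1 l -> represents1 r ->
  symmetric E -> starry E (Nd l r) O ->
  z1 \notin labels (Nd l r) -> z2 \notin labels (Nd l r) -> z1 != z2 ->
  b1 \in labels l -> b2 \in labels r ->
  exposed E O predT b1 -> exposed E O predT b2 ->
  (forall x, x \in labels l -> exposed E O predT x -> x = b1) ->
  (forall x, x \in labels r -> exposed E O predT x -> x = b2) ->
  lcentred E l r -> repr2 E (Nd l r) O chi z1 z2.
Proof.
move=> P1 P2 sE st; rewrite /= !inE !negb_or => /andP[z1l z1r] /andP[z2l z2r].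
move=> nez b1l b2r e1 e2 el er lc.
have dj := starry_disjoint st; case: (st) => _ _ _ stl str.
have b2l : b2 \notin labels l by apply/negP=> /dj/(_ b2r).
have b1r : b1 \notin labels r by apply/negP=> /(dj _ b1l).
(* Merging everything outside [l] into [b2] turns an edge from [b1] to [O] into [b1 b2], the edge
   along which K4 is glued. *)
have [F1 [g1 c1 o1 [d' d'l Fd']]] := P1 E _ b2 sE stl b2l.
have sF1 : symmetric F1 by case: g1.
have [|d [dl Fd cd]] := lcentred_pick lc sF1 _ d'l Fd'.
  by move=> x o xl orr; apply: o1; rewrite ?inE ?orr.
have dr : d \notin labels r by apply/negP => /(dj _ dl).
have [F2 [g2 c2 o2 _]] := P2 E _ d sE str dr.
have sF2 : symmetric F2 by case: g2.
have lr x y : x \in labels l -> y \in labels r -> E x y -> F2 x y.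
  move=> xl yr Exy; rewrite (cd x y xl yr Exy) sF2.
  by apply: (o2 y x yr); rewrite ?inE ?xl // sE.
set K := [set b1; b2; z1; z2].
have g3 : good K (clique K).
  by apply: good_clique; do ?[apply: leq_cardsU1|apply: leq_cards1U]; rewrite ?cards1.
have g12 : good ((b2 |: labels l) :|: (d |: labels r)) (relU F1 F2).
  apply: (good_sum g1 g2 (c := b2) (d := d)) => //; last first.
    (* An edge from [b2] to [O] has become [b2 d] in [F2], so both summands contain the shared
       edge. *)
    case/exposedP: e2 => o [oO _ Eo].
    by apply: (o2 b2 o); rewrite ?inE ?oO ?orbT.
  apply/setP=> x; rewrite !inE.
  case: (x =P b2) => [->|_] /=; first by rewrite b2r orbT.
  case: (x =P d) => [->|_] /=; first by rewrite dl.
  by apply/negP=> /andP[/dj].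
have b12 : b1 != b2 by apply: contraNneq b1r => ->.
have bz x z : (x \in labels l) || (x \in labels r) ->
    z \notin labels l -> z \notin labels r -> x != z.
  by move=> h zl zr; apply: contraTneq h => ->; rewrite (negPf zl) (negPf zr).
have b1z1 : b1 != z1 by apply: bz; rewrite ?b1l.
have b1z2 : b1 != z2 by apply: bz; rewrite ?b1l.
have b2z1 : b2 != z1 by apply: bz; rewrite ?b2r ?orbT.
have b2z2 : b2 != z2 by apply: bz; rewrite ?b2r ?orbT.
exists (relU (relU F1 F2) (clique K)); split.
- have -> : z1 |: (z2 |: (labels l :|: labels r)) =
    ((b2 |: labels l) :|: (d |: labels r)) :|: K.
    apply/setP=> x; rewrite !inE.
    case: (x =P d) => [->|_] /=; rewrite ?dl ?orbT //=.
    case: (x =P b1) => [->|_] /=; rewrite ?b1l ?orbT //=.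
    case: (x =P b2) => [->|_] /=; rewrite ?b2r ?orbT //=.
    by case: (x == z1); case: (x == z2); case: (_ \in _); case: (_ \in _).
  apply: (good_sum g12 g3 (c := b1) (d := b2)) => /=.
  + apply/setP=> x; rewrite !inE.
    case: (x =P b1) => [->|_] /=; first by rewrite b1l ?orbT.
    case: (x =P b2) => [->|_] //=.
    apply/negP=> /andP[/orP h h'].
    have hx : (x \in labels l) || (x \in labels r).
      by case: h => [->//|/orP[/eqP->|->]]; rewrite ?dl ?orbT.
    by case/orP: h' hx => /eqP ->; rewrite ?(negPf z1l) ?(negPf z2l) ?(negPf z1r) ?(negPf z2r).
  + case/exposedP: e1 => o [oO _ Eo].
    by rewrite (o1 b1 o) // ?inE ?oO ?orbT.
  + by rewrite /clique !inE !eqxx b12 ?orbT.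
- move=> x y; rewrite !inE => /orP[xl|xr] /orP[yl|yr] ne Exy /=.
  + by rewrite c1.
  + by rewrite lr ?orbT.
  + by rewrite sF2 lr ?orbT // sE.
  + by rewrite c2 ?orbT.
- move=> x o; rewrite !inE => /orP[xl|xr] oO Exo /=.
    rewrite (el x xl); last by apply/exposedP; exists o.
    by rewrite /clique; case: ifP; rewrite !inE !eqxx ?b1z1 ?b1z2 ?orbT.
  rewrite (er x xr); last by apply/exposedP; exists o.
  by rewrite /clique; case: ifP; rewrite !inE !eqxx ?b2z1 ?b2z2 ?orbT.
- by rewrite /= /clique !inE !eqxx nez ?orbT.
Qed.

(** Edges into different classes have different ends in [O], hence by [star] the same end in [X]. If
    both classes occur, every further edge differs in class from one of two chosen edges. *)
Lemma exposed_dichotomy E X O (chi : pred L) : star E X O ->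
  [\/ forall x, x \in X -> ~~ exposed E O (predC chi) x,
      forall x, x \in X -> ~~ exposed E O chi x |
      exists b, [/\ b \in X, exposed E O predT b &
        forall x, x \in X -> exposed E O predT x -> x = b]].
Proof.
move=> S.
case: (boolP [exists x in X, exposed E O (predC chi) x]); last first.
  by move=> /existsP N; constructor 1 => x xX; apply/negP=> e; case: N; exists x; rewrite xX.
move=> /existsP[x2 /andP[x2X /exposedP[o2 [o2O /= c2 E2]]]].
case: (boolP [exists x in X, exposed E O chi x]); last first.
  by move=> /existsP N; constructor 2 => x xX; apply/negP=> e; case: N; exists x; rewrite xX.
move=> /existsP[x1 /andP[x1X /exposedP[o1 [o1O c1 E1]]]].
have x12 : x1 = x2.
  case: (S _ _ _ _ x1X x2X o1O o2O E1 E2) => // eo.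
  by rewrite -eo c1 in c2.
subst x2; constructor 3; exists x1; split=> //; first by apply/exposedP; exists o1.
move=> x xX /exposedP[o [oO _ Eo]].
case: (boolP (chi o)) => co.
  case: (S _ _ _ _ xX x1X oO o2O Eo E2) => // eo.
  by rewrite -eo co in c2.
case: (S _ _ _ _ xX x1X oO o1O Eo E1) => // eo.
by rewrite eo c1 in co.
Qed.

Lemma exposed_predT E O (chi : pred L) x : exposed E O chi x -> exposed E O predT x.
Proof. by case/exposedP=> o [oO _ Eo]; apply/exposedP; exists o. Qed.

Lemma exposedCC E O (chi : pred L) x :
  exposed E O (predC (predC chi)) x = exposed E O chi x.
Proof. by apply: eq_existsb => o /=; rewrite negbK. Qed.

Lemma represents_btree t : represents1 t /\ represents2 t.
Proof.
elim: t => [a|l [IH1l IH2l] r [IH1r IH2r]].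
  split=> [E O z sE st|E O chi z1 z2 sE st]; rewrite /= !inE.
    move=> za; exists (clique [set z; a]); split.
    - by apply: good_clique; do ?[apply: leq_cardsU1|apply: leq_cards1U]; rewrite ?cards1.
    - by move=> x y; rewrite !inE => /eqP-> /eqP->; rewrite eqxx.
    - by move=> x o; rewrite !inE => /eqP-> _ _; rewrite /clique !inE !eqxx eq_sym za orbT.
    - by exists a; rewrite ?inE // /clique !inE !eqxx za orbT.
  move=> z1a z2a ne; exists (clique (z1 |: (z2 |: [set a]))); split.
  - by apply: good_clique; do ?[apply: leq_cardsU1|apply: leq_cards1U]; rewrite ?cards1.
  - by move=> x y; rewrite !inE => /eqP-> /eqP->; rewrite eqxx.
  - move=> x o; rewrite !inE => /eqP-> _ _; rewrite /clique !inE !eqxx ?orbT /=.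
    by case: ifP; rewrite ?eqxx ?orbT /= eq_sym.
  - by rewrite /clique !inE !eqxx ne ?orbT.
have IH1 : represents1 (Nd l r).
  move=> E O z sE st zt; case: (lcentredP sE st) => lc.
    exact: represents1_Nd lc.
  have zt' : z \notin labels (Nd r l) by rewrite /= setUC.
  by have := represents1_Nd IH1r IH2l sE (starryC sE st) zt' lc; rewrite /repr1 /= (setUC (labels r)).
split=> // E O chi z1 z2 sE st z1t z2t nez.
have [_ sl sr _ _] := st.
have sep (chi' : pred L) y1 y2 :
    y1 \notin labels (Nd l r) -> y2 \notin labels (Nd l r) -> y1 != y2 ->
    (forall x, x \in labels l -> ~~ exposed E O (predC chi') x) ->
    (forall x, x \in labels r -> ~~ exposed E O chi' x) ->
    repr2 E (Nd l r) O chi' y1 y2.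
  move=> h1 h2 h3 el er; case: (lcentredP sE st) => lc; first exact: repr2_separate.
  apply/repr2C/repr2_NdC; apply: repr2_separate lc => //=.
  - exact: starryC.
  - by rewrite setUC.
  - by rewrite setUC.
  - by rewrite eq_sym.
  - by move=> x xr; rewrite exposedCC er.
have single b : (forall x, x \in labels (Nd l r) ->
    exposed E O (predC chi) x -> x = b) -> repr2 E (Nd l r) O chi z1 z2.
  exact: repr2_single.
have singleC b : (forall x, x \in labels (Nd l r) ->
    exposed E O chi x -> x = b) -> repr2 E (Nd l r) O chi z1 z2.
  move=> h; apply/repr2C/repr2_single => //; first by rewrite eq_sym.
  by move=> x xt; rewrite exposedCC; apply: h.
have sepC : (forall x, x \in labels l -> ~~ exposed E O chi x) ->
    (forall x, x \in labels r -> ~~ exposed E O (predC chi) x) ->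
    repr2 E (Nd l r) O chi z1 z2.
  move=> el er; apply/repr2C/sep => //; first by rewrite eq_sym.
  by move=> x xl; rewrite exposedCC el.
(* Halves seeing opposite classes are separated, and two halves with a single exposed label each
   need K4. In all other cases some class is seen by at most one label. *)
case: (exposed_dichotomy chi sl) => [l2|l1|[b1 [b1l e1 el]]];
case: (exposed_dichotomy chi sr) => [r2|r1|[b2 [b2r e2 er]]].
(* No label sees the class of [z2]; [z1] is a dummy value here. *)
- by apply: (single z1) => x; rewrite inE => /orP[/l2|/r2] /negPf->.
- exact: sep.
- apply: (single b2) => x; rewrite inE => /orP[/l2/negPf->//|xr /exposed_predT].
  exact: er.
- exact: sepC.
- by apply: (singleC z1) => x; rewrite inE => /orP[/l1|/r1] /negPf->.
- apply: (singleC b2) => x; rewrite inE => /orP[/l1/negPf->//|xr /exposed_predT].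
  exact: er.
- apply: (single b1) => x; rewrite inE => /orP[xl /exposed_predT|/r2/negPf->//].
  exact: el.
- apply: (singleC b1) => x; rewrite inE => /orP[xl /exposed_predT|/r1/negPf->//].
  exact: el.
- case: (lcentredP sE st) => lc; first exact: (repr2_K4 _ IH1l IH1r sE st z1t z2t nez b1l b2r).
  apply: repr2_NdC; apply: (repr2_K4 _ IH1r IH1l _ _ _ _ _ b2r b1l) lc => //=.
  - exact: starryC.
  - by rewrite setUC.
  - by rewrite setUC.
Qed.

End CliqueSums.

(** * Branches of a tree and their leaves *)

Lemma connected_nbr (P : sgraph) (x : P) : connected_graph P -> 1 < #|P| ->
  exists y, adj x y.
Proof.
move=> [_ cP]; rewrite (cardD1 x) inE => h.
have /card_gt0P[v] : 0 < #|[predD1 P & x]| by [].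
rewrite !inE andbT => vx; have [p pp e] := connectP (cP x v).
case: p pp e => [|y p] /=; first by move=> _ e; rewrite e eqxx in vx.
by case/andP=> xy _ _; exists y.
Qed.

Section Trees.
Variable T : sgraph.
Implicit Types (x y c a b : T) (p : seq T).

Lemma card_nbrs x (s : seq T) : uniq s -> all (adj x) s -> size s <= degree x.
Proof.
move=> us /allP as_; rewrite /degree -(card_uniqP us).
by apply: subset_leq_card; apply/subsetP => z /as_; rewrite inE.
Qed.

Hypothesis Tacyclic : acyclic T.
Hypothesis Tconn : connected_graph T.

Definition adj_off y : rel T := fun a b => [&& adj a b, a != y & b != y].

(** For [c != y], the component of [c] in [T] minus [y]; an oriented edge [y c] thus names one side
    of that edge. *)
Definition branch y c : {set T} := [set v | connect (adj_off y) c v].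

Lemma adj_off_sym y : symmetric (adj_off y).
Proof. by move=> a b; rewrite /adj_off adj_sym (andbC (a != y)). Qed.

Lemma branchE y c v : (v \in branch y c) = connect (adj_off y) c v.
Proof. exact: in_set. Qed.

Lemma branch_root y c : c \in branch y c.
Proof. by rewrite branchE connect0. Qed.

Lemma branch_avoid y c v : c != y -> v \in branch y c -> v != y.
Proof.
move=> cy; rewrite branchE => /connectP[p]; elim: p c cy => [|b p IH] c cy /=; first by move=> _ ->.
by case/andP=> /and3P[_ _ by_] h e; apply: IH h e.
Qed.

Lemma branch_closed y c a b : c != y -> a \in branch y c -> adj a b -> b != y ->
  b \in branch y c.
Proof.
move=> cy ab ad by_; have ay := branch_avoid cy ab.
move: ab; rewrite !branchE => h; apply: connect_trans h (connect1 _).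
by rewrite /adj_off ad ay.
Qed.

(** Otherwise a simple path from [c] to [a] avoiding [y] closes up through [y] to a cycle. *)
Lemma branch_exit y c a : adj y c -> a \in branch y c -> adj a y -> a = c.
Proof.
move=> yc aB ay; apply/eqP/negP => /negP ac.
have cy : c != y by apply: contraTneq yc => ->; rewrite adj_irr.
move: aB; rewrite branchE => /connectP[p0 pp0 e0].
case/shortenP: pp0 e0 => p pp up _ ea.
have pa : path (@adj T) c p by apply: sub_path pp => u v /and3P[].
have py : y \notin c :: p.
  rewrite inE negb_or eq_sym cy /=; elim: p c {pa up ea cy yc ac} pp => //= z p IH c.
  by case/andP=> /and3P[_ _ zy] /IH; rewrite inE negb_or eq_sym zy.
case: (@Tacyclic (y :: c :: p)).
  by case: p ea {pp up pa py} => // /= ea; rewrite ea eqxx in ac.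
rewrite /ucycle /= rcons_path pa yc -ea ay /=.
by move: up => /= ->; rewrite andbT.
Qed.

Lemma branch_disjoint y c c' v : adj y c -> adj y c' ->
  v \in branch y c -> v \in branch y c' -> c = c'.
Proof.
move=> yc yc' vc; rewrite branchE => c'v; apply/esym.
apply: (branch_exit yc); last by rewrite adj_sym.
rewrite !branchE in vc *; apply: connect_trans vc _.
by rewrite (sym_connect_sym (adj_off_sym y)).
Qed.

Lemma adj_neq x y : adj x y -> y != x.
Proof. by apply: contraTneq => ->; rewrite adj_irr. Qed.

Lemma connect_closed (e : rel T) (Z : {set T}) a b :
  (forall u v, e u v -> u \in Z -> v \in Z) -> connect e a b -> a \in Z -> b \in Z.
Proof.
move=> cl /connectP[p]; elim: p a => [|c p IH] a /=; first by move=> _ ->.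
by case/andP=> eac pp eb aZ; apply: IH pp eb (cl _ _ eac aZ).
Qed.

(** A walk from [c] that avoids [y] could leave [branch x y] only by stepping onto [x], and
    [branch_exit] allows that step from [y] alone. *)
Lemma branch_sub x y c : adj x y -> adj y c -> c != x ->
  branch y c \subset branch x y.
Proof.
move=> xy yc cx; apply/subsetP => v vB.
have yx := adj_neq xy; have cy := adj_neq yc.
suff : v \in branch y c :&: branch x y by rewrite inE => /andP[].
move: (vB); rewrite branchE => h; apply: (connect_closed _ h).
  move=> a b /and3P[ab ay by_]; rewrite !in_setI => /andP[ac ax].
  rewrite (branch_closed cy ac ab by_) (branch_closed yx ax ab) //.
  apply: contraNneq ay => bx; rewrite bx in ab.
  by rewrite (branch_exit xy ax ab).
rewrite in_setI branch_root (branch_closed yx (branch_root _ _) yc cx) //.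
Qed.

Lemma branch_split x y v : adj x y -> v \in branch x y -> v != y ->
  exists c, [/\ adj y c, c != x & v \in branch y c].
Proof.
move=> xy vB vy; have yx := adj_neq xy.
pose Z := y |: [set v | [exists c, [&& adj y c, c != x & v \in branch y c]]].
have : v \in Z.
  move: vB; rewrite branchE => h; apply: (connect_closed _ h); last by rewrite !inE eqxx.
  move=> a b /and3P[ab ax bx]; rewrite !in_setU1 => /orP[/eqP ay|].
    apply/orP; right; rewrite inE; apply/existsP; exists b.
    by rewrite -ay ab bx branch_root.
  rewrite inE => /existsP[c /and3P[yc cx aB]].
  have [//|by_] := eqVneq b y; rewrite /= inE; apply/existsP; exists c.
  by rewrite yc cx (branch_closed (adj_neq yc) aB ab).
rewrite in_setU1 (negPf vy) inE => /existsP[c /and3P[]]; by exists c.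
Qed.

Lemma branch_cover y v : v != y -> exists2 c, adj y c & v \in branch y c.
Proof.
move=> vy; pose Z := y |: [set v | [exists c, adj y c && (v \in branch y c)]].
have : v \in Z.
  apply: (connect_closed _ (Tconn.2 y v)); last by rewrite !inE eqxx.
  move=> a b ab; rewrite !in_setU1 => /orP[/eqP ay|].
    apply/orP; right; rewrite inE; apply/existsP; exists b.
    by rewrite -ay ab branch_root.
  rewrite inE => /existsP[c /andP[yc aB]].
  have [//|by_] := eqVneq b y; rewrite /= inE; apply/existsP; exists c.
  by rewrite yc (branch_closed (adj_neq yc) aB ab).
rewrite in_setU1 (negPf vy) inE => /existsP[c /andP[]]; by exists c.
Qed.

Lemma connected_crosses (S : {set T}) y c a b :
  connected_graph (induced S) -> adj y c ->
  a \in S -> b \in S -> a \in branch y c -> b \notin branch y c ->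
  y \in S /\ c \in S.
Proof.
move=> [_ cS] yc aS bS aB bB.
have [p pp e] := connectP (cS (Sub a aS) (Sub b bS)).
have {}e : b = val (last (Sub a aS : induced S) p) by rewrite -e.
move: (Sub a aS : induced S) (erefl a : val (Sub a aS : induced S) = a) pp e => a' ea.
rewrite -ea in aB; elim: p a' {ea} aB => [|u p IH] a' aB /=.
  by move=> _ e; rewrite e aB in bB.
case/andP=> au pp e; have [uB|uB] := boolP (val u \in branch y c); first exact: IH uB pp e.
have uy : val u = y.
  by apply/eqP/negP=> /negP uy; rewrite (branch_closed (adj_neq yc) aB au) in uB.
have a'c : val a' = c by apply: (branch_exit yc aB); rewrite -uy.
by rewrite -uy -a'c; split; exact: valP.
Qed.

(** A longest simple path from [x] ends in a leaf: a second neighbour of its last vertex would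
    prolong the path or close a cycle. *)
Lemma tree_leaf_other x : 1 < #|T| -> exists2 l, l != x & leaf l.
Proof.
move=> cT.
pose P n := [exists t : n.-tuple T, path (@adj T) x t && uniq (x :: t)].
have P0 : exists n, P n.
  by exists 0; apply/existsP; exists [tuple].
have Pb n : P n -> n <= #|T|.
  move=> /existsP[t /andP[_ u]]; have := card_uniqP u; rewrite /= size_tuple => e.
  by apply: ltnW; rewrite -e max_card.
case: (ex_maxnP P0 Pb) => n /existsP[t /andP[pt ut]] mx.
have [m em] : exists m, n = m.+1.
  case: n t pt ut mx => [|m] t pt ut mx; last by exists m.
  have [y xy] := connected_nbr x Tconn cT.
  suff /mx : P 1 by [].
  apply/existsP; exists [tuple y]; by rewrite /= xy inE eq_sym (adj_neq xy).
subst n; set l := last x t.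
have tne : t != [::] :> seq T by rewrite -size_eq0 size_tuple.
exists l.
  case: (tval t) tne ut @l => // z s _ /= /andP[h _].
  by apply: contraNneq h => <-; rewrite mem_last.
rewrite /leaf /degree.
have [s es] : exists s, x :: t = rcons s l /\ s != [::].
  exists (belast x t); split; first by rewrite -lastI.
  by case: (tval t) tne.
case: es => es sne; set q := last x s.
have {}es : exists s', x :: t = rcons (rcons s' q) l.
  exists (belast (head x s) (behead s)); case: s sne es @q => // z s' _ -> q.
  by rewrite -lastI.
case: es => s' es.
have ps : sorted (@adj T) (rcons (rcons s' q) l) by rewrite -es.
have us : uniq (rcons (rcons s' q) l) by rewrite -es.
have ql : adj q l.
  move: ps; rewrite -!cats1 -catA => /cat_sorted2[_] /=; by rewrite andbT.
rewrite (@eq_card1 _ q) // => u; rewrite inE [RHS]inE; apply/idP/eqP=> [lu|->]; last by rewrite adj_sym.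
have [ut'|ut'] := boolP (u \in x :: t); last first.
  have : P m.+2.
    apply/existsP; exists [tuple of rcons t u].
    by rewrite -rcons_cons rcons_uniq ut ut' rcons_path pt lu.
  by move/mx; rewrite ltnn.
apply/eqP/negP => /negP uq; rewrite es in ut'.
have ul : u != l by apply: contraTneq lu => ->; rewrite adj_irr.
rewrite mem_rcons inE (negPf ul) /= mem_rcons inE (negPf uq) /= in ut'.
have [i1 [i2 e12]] : exists i1 i2, s' = i1 ++ u :: i2.
  by case/splitPr: ut' => i1 i2; exists i1, i2.
rewrite e12 !rcons_cat /= in us ps.
have {ps}/= ps := (cat_sorted2 ps).2.
have {us}us : uniq (u :: rcons (rcons i2 q) l) by move: us; rewrite cat_uniq => /and3P[].
apply: (@Tacyclic (u :: rcons (rcons i2 q) l)); first by rewrite /= !size_rcons.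
rewrite /ucycle us andbT /= rcons_path ps /= last_rcons //.
Qed.

Section BranchTree.
Hypothesis Tdeg : maxdeg_le T 3.
Let L : finType := {x : T | leaf x}.
Variable E : rel L.

Definition leaves_in (B : {set T}) : {set L} := [set a : L | val a \in B].

Lemma leaves_inE B (a : L) : (a \in leaves_in B) = (val a \in B).
Proof. exact: in_set. Qed.

Hypothesis Estar : forall y c1 c2, adj y c1 -> adj y c2 -> c1 != c2 ->
  star E (leaves_in (branch y c1)) (leaves_in (branch y c2)).

(** The neighbours of [y] other than [x] decide: two give a node, a single one is skipped over, and
    none makes [y] itself a leaf. *)
Lemma branch_btree n x y : adj x y -> #|branch x y| <= n ->
  exists2 t : btree L, labels t = leaves_in (branch x y) &
    starry E t (~: leaves_in (branch x y)).
Proof.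
elim: n x y => [|n IH] x y xy.
  by rewrite leqn0 cards_eq0 => /eqP e; have := branch_root x y; rewrite e inE.
move=> cB; have yx := adj_neq xy; have yB := branch_root x y.
pose C := [set c | adj y c && (c != x)].
have degC : degree y = #|C|.+1.
  have -> : degree y = #|[set c | adj y c]| by rewrite cardsE.
  rewrite (cardsD1 x) in_set adj_sym xy; congr _.+1.
  by apply: eq_card => c; rewrite !inE andbC.
have CP c : c \in C -> adj y c /\ c != x by rewrite inE => /andP.
have small c : c \in C -> #|branch y c| <= n.
  case/CP=> yc cx; rewrite -ltnS; apply: leq_trans cB; apply: proper_card.
  rewrite properE branch_sub //; apply/subsetPn; exists y => //.
  by apply/negP => /(branch_avoid (adj_neq yc)); rewrite eqxx.
have leafy (a : L) : C != set0 -> val a != y.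
  move=> C0; apply: contraNneq C0 => ay; rewrite -cards_eq0.
  by have := valP a; rewrite /leaf ay degC.
have split c (a : L) : c \in C -> val a \in branch y c -> val a \in branch x y.
  by case/CP=> yc cx; apply: (subsetP (branch_sub xy yc cx)).
have unsplit (a : L) : C != set0 -> val a \in branch x y ->
    exists2 c, c \in C & val a \in branch y c.
  move=> C0 aB; have [c [yc cx h]] := branch_split xy aB (leafy a C0).
  by exists c; rewrite // inE yc.
have := Tdeg y; rewrite degC ltnS leq_eqVlt => /orP[/cards2P[c1 [c2 [c12 eC]]]|].
  have c1C : c1 \in C by rewrite eC !inE eqxx.
  have c2C : c2 \in C by rewrite eC !inE eqxx orbT.
  have C0 : C != set0 by apply/set0Pn; exists c1.
  have [[yc1 c1x] [yc2 c2x]] := (CP _ c1C, CP _ c2C).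
  have [l el sl] := IH y c1 yc1 (small _ c1C).
  have [r er sr] := IH y c2 yc2 (small _ c2C).
  have dis (a : L) : val a \in branch y c1 -> val a \notin branch y c2.
    by move=> h; apply: contra c12 => h'; apply/eqP/(branch_disjoint yc1 yc2 h h').
  have eB (a : L) : (val a \in branch x y) =
      (val a \in branch y c1) || (val a \in branch y c2).
    apply/idP/orP => [/(unsplit _ C0)[c]|[]]; last 2 first.
    - exact: split.
    - exact: split.
    by rewrite eC !inE => /orP[]/eqP->; [left|right].
  (* Leaves outside lie in the branch at [y] through [x], so the star conditions towards the outside
     are again instances of [Estar] at [y]. *)
  have out (b : L) : val b \notin branch x y -> val b \in branch y x.
    move=> bB; have [c yc h] := branch_cover (leafy b C0).
    have [<-//|cx] := eqVneq c x; case/negP: bB.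
    by apply: (split c) => //; rewrite inE yc.
  have sO c : c \in C -> star E (leaves_in (branch y c))
      (~: leaves_in (branch x y)).
    case/CP=> yc cx a a' b b' ac ac'; rewrite !in_setC !leaves_inE => /out bx /out bx'.
    have yx' : adj y x by rewrite adj_sym.
    by apply: (Estar yc yx' cx) => //; rewrite leaves_inE.
  exists (Nd l r) => /=.
    by rewrite el er; apply/setP => a; rewrite ?in_setU ?in_setC ?in_set1 !leaves_inE eB.
  rewrite el er; split; [exact: Estar|exact: sO|exact: sO| |].
    suff -> : leaves_in (branch y c2) :|: ~: leaves_in (branch x y) =
        ~: leaves_in (branch y c1) by [].
    apply/setP => a; rewrite ?in_setU ?in_setC ?in_set1 !leaves_inE eB.
    by case: (boolP (_ \in branch y c1)) => [/dis/negPf->|_]; rewrite //= orbN.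
  suff -> : leaves_in (branch y c1) :|: ~: leaves_in (branch x y) =
      ~: leaves_in (branch y c2) by [].
  apply/setP => a; rewrite ?in_setU ?in_setC ?in_set1 !leaves_inE eB.
  case: (boolP (_ \in branch y c1)) => [/dis->|_] //.
rewrite ltnS leq_eqVlt => /orP[/cards1P[c eC]|].
  have cC : c \in C by rewrite eC !inE eqxx.
  have C0 : C != set0 by apply/set0Pn; exists c.
  have [yc cx] := CP _ cC.
  have [t et st] := IH y c yc (small _ cC).
  have eB (a : L) : (val a \in branch x y) = (val a \in branch y c).
    apply/idP/idP => [/(unsplit _ C0)[c']|]; last exact: split.
    by rewrite eC inE => /eqP->.
  exists t; first by rewrite et; apply/setP => a; rewrite ?in_setU ?in_setC ?in_set1 !leaves_inE eB.
  suff -> : ~: leaves_in (branch x y) = ~: leaves_in (branch y c) by [].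
  by apply/setP => a; rewrite ?in_setU ?in_setC ?in_set1 !leaves_inE eB.
rewrite ltnS leqn0 cards_eq0 => /eqP C0.
have ly : leaf y by rewrite /leaf degC C0 cards0.
have eB (a : L) : (val a \in branch x y) = (a == Sub y ly).
  apply/idP/eqP => [aB|->//]; apply: val_inj; apply/eqP/negP => /negP ay.
  have [c [yc cx _]] := branch_split xy aB ay.
  have : c \in C by rewrite inE yc.
  by rewrite C0 inE.
exists (Lf (Sub y ly : L)); first by apply/setP => a; rewrite ?in_setU ?in_setC ?in_set1 !leaves_inE eB.
by rewrite /= in_setC leaves_inE negbK.
Qed.

End BranchTree.
End Trees.

(** A simple path from [a] to [b] cannot be left: inner vertices have both neighbours on it, and [a]
    and [b] their only one. By connectedness it covers [P], and its inner vertices are not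
    leaves. *)
Lemma path_graph_leaves (P : sgraph) (a b c : P) : connected_graph P ->
  maxdeg_le P 2 -> leaf a -> leaf b -> leaf c -> a != b -> c = a \/ c = b.
Proof.
move=> [_ cP] dP la lb lc ab.
have [p0 pp0 e0] := connectP (cP a b).
case/shortenP: pp0 e0 => p pp up _ eb.
have mid s1 s2 w u z : a :: p = rcons s1 w ++ u :: z :: s2 ->
    [/\ adj u w, adj u z & w != z].
  move=> e; have : sorted (@adj P) (a :: p) by [].
  rewrite e -cats1 -catA => /cat_sorted2[_] /= /and3P[wu uz _].
  move: up; rewrite e -cats1 -catA cat_uniq => /and3P[_ _ /=].
  by rewrite !inE !negb_or => /andP[/and3P[_ ? _] _]; rewrite adj_sym wu.
have ends u : u \in a :: p -> [\/ u = a, u = b |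
    exists w z, [/\ adj u w, adj u z, w != z & (w \in a :: p) && (z \in a :: p)]].
  case/splitPr e : {1}_ / => [s1 s2].
  case/lastP: s1 e => [[->] _|s1 w]; first by constructor 1.
  case: s2 => [|z s2] e.
    by constructor 2; rewrite eb -(last_cons a) e last_cat.
  constructor 3; exists w, z; have [h1 h2 h3] := mid _ _ _ _ _ e; split=> //.
  by rewrite e !mem_cat !inE mem_rcons !inE !eqxx ?orbT.
have one (u v w : P) : leaf u -> adj u v -> adj u w -> v = w.
  move=> /eqP lu uv uw; apply/eqP/negP=> /negP ne.
  by have := @card_nbrs P u [:: v; w]; rewrite /= inE ne uv uw lu => /(_ isT isT).
have cp : c \in a :: p.
  have closed u v : adj u v -> u \in [set x in a :: p] -> v \in [set x in a :: p].
    move=> uv; rewrite !in_set => uin.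
    have [ua|ub|[w [z [uw uz wz /andP[wp zp]]]]] := ends u uin.
    - case: p pp up eb {mid ends uin} => [|z p] /=; first by move=> _ _ e; rewrite e eqxx in ab.
      case/andP=> az _ _ _; rewrite ua in uv.
      by rewrite (one a v z) // !inE eqxx orbT.
    - case/lastP: p pp up eb {mid ends uin} => [|p z] /=; first by move=> _ _ e; rewrite e eqxx in ab.
      rewrite rcons_path last_rcons => /andP[_ lz] _ bz; rewrite ub in uv.
      rewrite (one b v (last a p)) //; last by rewrite bz adj_sym.
      by rewrite -rcons_cons mem_rcons inE mem_last orbT.
    - have [->//|vw] := eqVneq v w; have [->//|vz] := eqVneq v z.
      have := @card_nbrs P u [:: v; w; z].
      rewrite /= !inE !negb_or vw vz wz uv uw uz => /(_ isT isT) h.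
      by have := leq_trans h (dP u).
  by have := connect_closed closed (cP a c); rewrite !in_set mem_head => /(_ isT).
have [->|->|[w [z [cw cz /eqP wz _]]]] := ends c cp; [by left|by right|].
by case: wz; apply: one lc cw cz.
Qed.

(** * The graph on the leaves of the host tree *)

Section Representation.
Variables (G T : sgraph) (S : G -> {set T}).
Hypotheses (Gconn : connected_graph G) (Gtwf : twin_free G) (Gord : 4 <= #|G|).
Hypothesis orth : orth_representation 3 2 3 S.

Let L : finType := {x : T | leaf x}.
Let ends u : {set L} := leaves_in (S u).

Let Ttree : tree T. Proof. by case: orth. Qed.
Let Tconn : connected_graph T := Ttree.1.
Let Tacyclic : acyclic T := Ttree.2.
Let Tdeg : maxdeg_le T 3. Proof. by case: orth. Qed.

Let adj_meet u v : u <> v -> adj u v <-> 3 <= #|S u :&: S v|.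
Proof. by case: orth => _ _ _ _ h /h[]. Qed.

Let adj_leaf u v : u <> v ->
  adj u v <-> exists2 x : T, leaf x & x \in S u :&: S v.
Proof. by case: orth => _ _ _ _ h /h[]. Qed.

(** Some neighbour exists, and adjacency costs three common vertices. This rules out the one-vertex
    subtree, which has no vertex of degree 1. *)
Lemma subtree_size u : 2 < #|S u|.
Proof.
have [|v uv] := connected_nbr u Gconn; first exact: leq_trans Gord.
have ne : u <> v by move=> e; rewrite e adj_irr in uv.
by apply: leq_trans ((adj_meet ne).1 uv) _; rewrite subset_leq_card // subsetIl.
Qed.

(** The leaves of [T] in [S u] are the two leaves of the path [S u]: one inclusion is given by the
    representation, the other holds since degrees do not grow in the subtree and connectedness keeps
    them positive. *)
Lemma subtree_ends u : #|ends u| = 2.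
Proof.
have [_ _ /(_ u)[[cP aP] dP] lS _] := orth; have {}lS := lS u.
set P := induced (S u) in cP aP dP lS.
have sP : 1 < #|P| by rewrite card_sig; apply: ltnW; exact: subtree_size.
have [x0 _] : exists x0 : P, true by case/card_gt0P: (ltnW sP) => x0; exists x0.
have [l1 _ leaf1] := tree_leaf_other aP cP x0 sP.
have [l2 ne leaf2] := tree_leaf_other aP cP l1 sP.
have -> : ends u = [set Sub (val l1) (lS _ leaf1); Sub (val l2) (lS _ leaf2)].
  apply/setP => a; rewrite leaves_inE in_set2; apply/idP/orP; last first.
    by case=> /eqP->; [exact: (valP l1)|exact: (valP l2)].
  move=> aS; pose a' : P := Sub (val a) aS.
  have leafa : leaf a'.
    rewrite /leaf eqn_leq; apply/andP; split.
      rewrite -(eqP (valP a)) /degree -(card_image val_inj).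
      apply: subset_leq_card; apply/subsetP => x /imageP[y]; rewrite !inE => h ->.
      exact: h.
    by have [y ay] := connected_nbr a' cP sP; apply/card_gt0P; exists y; rewrite inE.
  have ne' : l1 != l2 by rewrite eq_sym.
  case: (path_graph_leaves cP dP leaf1 leaf2 leafa ne') => e; [left|right];
    by apply/eqP/val_inj; rewrite /= -e.
rewrite cards2; case: eqP => // -[] /val_inj e; by rewrite e eqxx in ne.
Qed.

Lemma adj_ends u v : adj u v = (u != v) && ~~ [disjoint ends u & ends v].
Proof.
have [->|/eqP ne] := eqVneq u v; first by rewrite adj_irr.
apply/idP/idP => [/(adj_leaf ne).1[x lx]|/pred0Pn[a]].
  rewrite inE => /andP[xu xv]; apply/pred0Pn; exists (Sub x lx : L).
  by rewrite /= !leaves_inE xu.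
rewrite /= !leaves_inE => h; apply/(adj_leaf ne).2.
by exists (val a); [exact: valP|rewrite inE].
Qed.

Lemma ends_meet u : ~~ [disjoint ends u & ends u].
Proof. by rewrite -setI_eq0 setIid -cards_eq0 subtree_ends. Qed.

(** Adjacency depends on the ends only, so equal ends give equal closed neighbourhoods. *)
Lemma ends_inj : injective ends.
Proof.
move=> u v e; apply/eqP/negP => /negP ne; apply: (@Gtwf u v); split; first exact/eqP.
have cE w : closed_nbhd w = [set z | ~~ [disjoint ends w & ends z]].
  apply/setP => z; rewrite !inE adj_ends (eq_sym z).
  by case: eqVneq => [->|] //=; rewrite ends_meet.
by rewrite !cE e.
Qed.

Definition ends_adj : rel L := fun a b =>
  (a != b) && [exists u, ends u == [set a; b]].

Lemma ends_adj_sym : symmetric ends_adj.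
Proof. by move=> a b; rewrite /ends_adj eq_sym setUC. Qed.

Lemma ends_adj_irr : irreflexive ends_adj.
Proof. by move=> a; rewrite /ends_adj eqxx. Qed.

Definition ends_graph : sgraph := SGraph ends_adj_sym ends_adj_irr.

Lemma edges_ends_graph (E : {set ends_graph}) :
  reflect (exists u, ends u = E) (E \in edges ends_graph).
Proof.
rewrite inE; apply: (iffP existsP) => [[a /existsP[b /andP[/andP[_ /existsP[u /eqP e]] /eqP->]]]|[u <-]].
  by exists u.
have /eqP/cards2P[a [b [ab e]]] := subtree_ends u.
exists a; apply/existsP; exists b; rewrite e eqxx andbT /= /ends_adj ab /=.
by apply/existsP; exists u; rewrite e.
Qed.

Lemma isomorphic_line_ends_graph : isomorphic G (line_graph ends_graph).
Proof.
have eu u : ends u \in edges ends_graph by apply/edges_ends_graph; exists u.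
pose f u : line_graph ends_graph := Sub (ends u) (eu u).
have finj : injective f by move=> u v /(congr1 val) /= /ends_inj.
exists f; last first.
  by move=> u v; rewrite adj_ends /= /line_adj (inj_eq finj).
have surj (E : line_graph ends_graph) : exists u, f u = E.
  case: E => E hE; have /edges_ends_graph[u e] := hE.
  by exists u; apply: val_inj.
have [g fg] := @fin_all_exists _ (fun=> G) (fun E u => f u = E) surj.
by exists g => // u; apply: finj; rewrite fg.
Qed.

(** Both paths contain [y], [c1] and [c2]. If they are distinct, these three common vertices make
    [u] and [v] adjacent, so they share an end; no leaf lies in both branches, so it is an end on
    the same side of each. *)
Lemma ends_adj_star y c1 c2 : adj y c1 -> adj y c2 -> c1 != c2 ->
  star ends_adj (leaves_in (branch y c1)) (leaves_in (branch y c2)).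
Proof.
move=> yc1 yc2 c12 a a' b b'; rewrite !leaves_inE => a1 a1' b2 b2'.
move=> /andP[_ /existsP[u /eqP eu]] /andP[_ /existsP[v /eqP ev]].
have off (d : L) : val d \in branch y c2 -> val d \notin branch y c1.
  by move=> d2; apply: contra c12 => d1; apply/eqP/(branch_disjoint Tacyclic yc1 yc2 d1 d2).
have off' (d : L) : val d \in branch y c1 -> val d \notin branch y c2.
  by move=> d1; apply: contraTN d1; exact: off.
have thru w d e : ends w = [set d; e] -> val d \in branch y c1 ->
    val e \in branch y c2 -> [set y; c1; c2] \subset S w.
  move=> ew d1 e2.
  have dS : val d \in S w by rewrite -leaves_inE -/(ends w) ew !inE eqxx.
  have eS : val e \in S w by rewrite -leaves_inE -/(ends w) ew !inE eqxx orbT.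
  have cS : connected_graph (induced (S w)) by case: orth => _ _ /(_ w)[[]].
  have [yS c1S] := connected_crosses Tacyclic cS yc1 dS eS d1 (off _ e2).
  have [_ c2S] := connected_crosses Tacyclic cS yc2 eS dS e2 (off' _ d1).
  by rewrite !subUset !sub1set yS c1S c2S.
have meet : ~~ [disjoint ends u & ends v].
  have [<-|/eqP uv] := eqVneq u v; first exact: ends_meet.
  have : adj u v.
    apply/(adj_meet uv).2.
    apply: leq_trans (subset_leq_card (_ : [set y; c1; c2] \subset _)); last first.
      by rewrite subsetI (thru u a b) // (thru v a' b').
    rewrite cardsU cards2 cards1 eq_sym (adj_neq yc1).
    suff -> : [set y; c1] :&: [set c2] = set0 by rewrite cards0.
    apply/setP => x; rewrite !inE; apply/negP=> /andP[h /eqP ex].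
    by rewrite ex (negPf (adj_neq yc2)) eq_sym (negPf c12) in h.
  by rewrite adj_ends => /andP[].
case/pred0Pn: meet => x /=; rewrite eu ev !inE.
case/andP=> /orP[]/eqP-> /orP[]/eqP e; [by left| | |by right].
  by move: (off _ b2'); rewrite -e a1.
by move: (off _ b2); rewrite e a1'.
Qed.

(** Rooted at a leaf [z], the tree has all other leaves in one branch. The outside is then [z]
    alone, and merging it into [z] changes nothing. *)
Lemma ends_graph_good : exists (F : rel L) (z d : L),
  [/\ good [set: L] F, F z d & subrel ends_adj F].
Proof.
have [u _] := card_gt0P (leq_trans (isT : 0 < 4) Gord).
have /card_gt0P[z _] : 0 < #|ends u| by rewrite subtree_ends.
have sT : 1 < #|T| by apply: leq_trans (max_card (S u)); apply: ltnW; exact: subtree_size.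
have [y zy] := connected_nbr (val z) Tconn sT.
have [t lt st] := branch_btree Tacyclic Tconn Tdeg ends_adj_star zy (leqnn _).
have zt : z \notin labels t.
  rewrite lt leaves_inE; apply/negP => /(branch_avoid (adj_neq zy)).
  by rewrite eqxx.
have all : z |: labels t = [set: L].
  apply/setP => a; rewrite in_setU1 in_setT lt leaves_inE.
  have [//|az] := eqVneq a z.
  have {}az : val a != val z by rewrite (inj_eq val_inj).
  have [c zc aB] := branch_cover Tconn az.
  suff <- : c = y by [].
  apply/eqP/negP => /negP cy.
  have := @card_nbrs T (val z) [:: c; y].
  by rewrite /= inE cy zc zy (eqP (valP z)) => /(_ isT isT).
have [F [gF cF oF [d dt Fzd]]] := (represents_btree t).1 _ _ z ends_adj_sym st zt.
exists F, z, d; split=> //; first by rewrite -all.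
have sF : symmetric F by case: gF.
have zO : z \in ~: leaves_in (branch (val z) y) by rewrite in_setC -lt.
move=> a b ab; have nab : a != b by case/andP: ab.
have ina x : (x == z) || (x \in labels t) by rewrite -in_setU1 all in_setT.
case/orP: (ina a) => [/eqP az|at_]; case/orP: (ina b) => [/eqP bz|bt].
- by rewrite az bz eqxx in nab.
- by rewrite az sF; apply: (oF b z) => //; rewrite ends_adj_sym -az.
- by rewrite bz; apply: (oF a z) => //; rewrite -bz.
- exact: cF.
Qed.

End Representation.

From mathcomp Require Import all_classical reals topology normedtype.

Import Order.TTheory GRing.Theory Num.Theory.
Import numFieldNormedType.Exports.

(** * Triangles divided at their centroid *)

Section Geometry.
Local Open Scope ring_scope.
Variable R : realType.
Implicit Types (A B C p q : R * R).

(** Twice the signed area of the triangle [A B p], positive when counterclockwise. *)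
Definition orient A B p : R :=
  (B.1 - A.1) * (p.2 - A.2) - (B.2 - A.2) * (p.1 - A.1).

Record triangle := Triangle { tA : R * R; tB : R * R; tC : R * R }.
Implicit Types (f : triangle).

Definition rotate f := Triangle (tB f) (tC f) (tA f).

Definition positive f := 0 < orient (tA f) (tB f) (tC f).

Definition inside f p : Prop :=
  [/\ 0 < orient (tA f) (tB f) p, 0 < orient (tB f) (tC f) p &
      0 < orient (tC f) (tA f) p].

Definition centroid f : R * R :=
  (((tA f).1 + (tB f).1 + (tC f).1) / 3, ((tA f).2 + (tB f).2 + (tC f).2) / 3).

Definition corner f p : Prop := [\/ p = tA f, p = tB f | p = tC f].

Definition segpt p q (t : R) : R * R :=
  (p.1 + t * (q.1 - p.1), p.2 + t * (q.2 - p.2)).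

Definition segment p q x : Prop := exists2 t, 0 <= t <= 1 & x = segpt p q t.

Definition cone f := Triangle (tA f) (tB f) (centroid f).

Lemma segmentC p q x : segment p q x -> segment q p x.
Proof.
case=> t /andP[t0 t1] ->; exists (1 - t); first by apply/andP; split; lra.
by rewrite /segpt; congr pair; ring.
Qed.

Lemma positive_rotate f : positive f -> positive (rotate f).
Proof.
by rewrite /positive; congr (0 < _); rewrite /orient /=; ring.
Qed.

Lemma inside_rotate f p : inside (rotate f) p <-> inside f p.
Proof. by rewrite /inside /=; split=> -[]. Qed.

Lemma centroid_rotate f : centroid (rotate f) = centroid f.
Proof. by rewrite /centroid /=; congr pair; congr (_ / _); ring. Qed.

(* Up to scaling, the three [orient] values are the barycentric coordinates of
   [p], and passing to the cone at the centroid compares them. *)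
Lemma insideP f p : inside (cone f) p <->
  0 < orient (tA f) (tB f) p /\
  orient (tA f) (tB f) p < orient (tB f) (tC f) p /\
  orient (tA f) (tB f) p < orient (tC f) (tA f) p.
Proof.
have e1 : orient (tB f) (centroid f) p =
    (orient (tB f) (tC f) p - orient (tA f) (tB f) p) / 3.
  by rewrite /orient /centroid /=; field.
have e2 : orient (centroid f) (tA f) p =
    (orient (tC f) (tA f) p - orient (tA f) (tB f) p) / 3.
  by rewrite /orient /centroid /=; field.
rewrite /inside /= e1 e2.
by split=> [[h1 h2 h3]|[h1 [h2 h3]]]; do ?split; lra.
Qed.

Lemma cone_inside f p : inside (cone f) p -> inside f p.
Proof. by move/insideP=> [h1 [h2 h3]]; split; lra. Qed.

Lemma positive_cone f : positive f -> positive (cone f).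
Proof.
rewrite /positive /= => h.
suff -> : orient (tA f) (tB f) (centroid f) = orient (tA f) (tB f) (tC f) / 3 by lra.
by rewrite /orient /centroid /=; field.
Qed.

Lemma inside_centroid f : positive f -> inside f (centroid f).
Proof.
rewrite /positive => h; rewrite /inside.
have -> : orient (tA f) (tB f) (centroid f) = orient (tA f) (tB f) (tC f) / 3.
  by rewrite /orient /centroid /=; field.
have -> : orient (tB f) (tC f) (centroid f) = orient (tA f) (tB f) (tC f) / 3.
  by rewrite /orient /centroid /=; field.
have -> : orient (tC f) (tA f) (centroid f) = orient (tA f) (tB f) (tC f) / 3.
  by rewrite /orient /centroid /=; field.
by split; lra.
Qed.

(** On the spoke to [tA] the coordinates belonging to [tB] and [tC] stay equal, and for positive [f]
    and [0 <= t] they do not exceed that of [tA]. The facts on spokes below are read off from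
    this. *)
Lemma orient_spoke f t (p := segpt (centroid f) (tA f) t)
    (D := orient (tA f) (tB f) (tC f)) :
  [/\ orient (tA f) (tB f) p = (1 - t) * D / 3,
      orient (tC f) (tA f) p = (1 - t) * D / 3 &
      orient (tB f) (tC f) p = D / 3 + t * (D * 2 / 3)].
Proof. by rewrite /p /D /segpt /orient /centroid /=; split; field. Qed.

Lemma spokeA f p : positive f -> segment (centroid f) (tA f) p ->
  p = tA f \/ inside f p.
Proof.
move=> h [t /andP[t0 t1] ->].
have [->|tn] := eqVneq t 1.
  by left; rewrite /segpt [tA f]surjective_pairing /=; congr pair; ring.
right; have [e1 e2 e3] := orient_spoke f t.
have {tn}t1 : t < 1 by rewrite lt_neqAle tn.
move: h; rewrite /positive => h.
by split; rewrite ?e1 ?e2 ?e3; nra.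
Qed.

Lemma spokeA_cone f p : positive f -> segment (centroid f) (tA f) p ->
  [/\ ~ inside (cone f) p, ~ inside (cone (rotate f)) p &
      ~ inside (cone (rotate (rotate f))) p].
Proof.
rewrite /positive => h [t /andP[t0 t1] ->]; have [e1 e2 e3] := orient_spoke f t.
split=> /insideP /=; rewrite ?e1 ?e2 ?e3; first by lra.
  by move=> [_ [_]]; nra.
by lra.
Qed.

Lemma spokeAB f p : positive f -> segment (centroid f) (tA f) p ->
  segment (centroid f) (tB f) p -> p = centroid f.
Proof.
rewrite /positive => h [t /andP[t0 t1] ->]; have [e1 e2 e3] := orient_spoke f t.
case=> s /andP[s0 s1] e.
have [d1 d2 d3] := orient_spoke (rotate f) s.
rewrite centroid_rotate /= -e in d1 d2 d3.
have hD : orient (tB f) (tC f) (tA f) = orient (tA f) (tB f) (tC f).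
  by rewrite /orient; ring.
rewrite hD in d1 d2 d3.
move: e1 e2 e3 d1 d2 d3; set D := orient _ _ (tC f) in h *.
move=> e1 e2 e3 d1 d2 d3.
(* On the spoke to [tB] the [orient] values for the sides [tA tB] and [tB tC] agree; on the spoke to
   [tA] they differ by [t * D]. *)
have ts : t * D = 0 by nra.
have -> : t = 0 by move/eqP: ts; rewrite mulf_eq0 => /orP[/eqP//|/eqP D0]; lra.
by rewrite /segpt [centroid f]surjective_pairing /=; congr pair; ring.
Qed.

Definition subface f g := [\/ g = cone f, g = cone (rotate f) | g = cone (rotate (rotate f))].

Lemma subface_inside f g p : subface f g -> inside g p -> inside f p.
Proof.
by case=> -> /cone_inside // => [|/inside_rotate] /inside_rotate.
Qed.

Lemma subface_positive f g : positive f -> subface f g -> positive g.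
Proof.
by move=> h [->|->|->]; apply: positive_cone => //; do !apply: positive_rotate.
Qed.

(** Each subface has its own [orient] value as the strict minimum. *)
Lemma subface_eq f g g' p : subface f g -> subface f g' ->
  inside g p -> inside g' p -> g = g'.
Proof.
case: f => A B C.
by move=> [->|->|->] [->|->|->] // /insideP /= ? /insideP /= ?; exfalso; lra.
Qed.

Lemma subface_centroid f g : subface f g -> corner g (centroid f).
Proof. by case=> ->; constructor 3; rewrite /= ?centroid_rotate. Qed.

(** Keeps an edge that lay on [f] on some face after the division. *)
Lemma subface_corners f x y : corner f x -> corner f y ->
  exists g, [/\ subface f g, corner g x & corner g y].
Proof.
pose f1 := cone f; pose f2 := cone (rotate f); pose f3 := cone (rotate (rotate f)).
have s1 : subface f f1 by constructor 1.
have s2 : subface f f2 by constructor 2.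
have s3 : subface f f3 by constructor 3.
have cA1 : corner f1 (tA f) by constructor 1.
have cB1 : corner f1 (tB f) by constructor 2.
have cB2 : corner f2 (tB f) by constructor 1.
have cC2 : corner f2 (tC f) by constructor 2.
have cC3 : corner f3 (tC f) by constructor 1.
have cA3 : corner f3 (tA f) by constructor 2.
by case=> -> [] ->; by [exists f1; split|exists f2; split|exists f3; split].
Qed.

Lemma spoke f X p : positive f -> corner f X -> segment (centroid f) X p ->
  p = X \/ inside f p.
Proof.
move=> h [->|->|->]; first exact: spokeA.
  rewrite -centroid_rotate => /(spokeA (positive_rotate h)) [->|/inside_rotate]; by [left|right].
rewrite -centroid_rotate -centroid_rotate => /(spokeA (positive_rotate (positive_rotate h))).
by case=> [->|/inside_rotate/inside_rotate]; by [left|right].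
Qed.

Lemma spoke_subface f g X p : positive f -> corner f X ->
  segment (centroid f) X p -> subface f g -> ~ inside g p.
Proof.
move=> h; have h1 := positive_rotate h; have h2 := positive_rotate h1.
have r3 : rotate (rotate (rotate f)) = f by case: (f).
case=> ->; last rewrite -centroid_rotate -centroid_rotate; first by move=> /(spokeA_cone h)[? ? ?] [->|->|->].
  rewrite -centroid_rotate => /(spokeA_cone h1); rewrite r3.
  by move=> [? ? ?] [->|->|->].
move=> /(spokeA_cone h2); rewrite r3.
by move=> [? ? ?] [->|->|->].
Qed.

Lemma spokes_meet f X Y p : positive f -> corner f X -> corner f Y -> X <> Y ->
  segment (centroid f) X p -> segment (centroid f) Y p -> p = centroid f.
Proof.
move=> h; have h1 := positive_rotate h; have h2 := positive_rotate h1.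
have AB := @spokeAB f p h; have BC := @spokeAB _ p h1; have CA := @spokeAB _ p h2.
rewrite !centroid_rotate /= in BC CA.
by case=> -> [->|->|->] ne ? ?; by [case: ne|apply: AB|apply: BC|apply: CA].
Qed.

(** * Straight-line drawings grown inside empty triangles *)

Section Drawing.
Variable L : finType.
Implicit Types (V N : {set L}) (D : L -> L -> Prop) (pos : L -> R * R).
Implicit Types (Fs : triangle -> Prop).

(* Each edge is recorded in [D] in one direction only; [Fs] is a family of empty
   triangles with disjoint interiors. *)
Record drawn V D pos Fs : Prop := Drawn {
  drawn_inj : {in V &, injective pos};
  drawn_edge : forall a b, D a b -> [/\ a \in V, b \in V & a <> b];
  drawn_vertex : forall a b w, D a b -> w \in V ->
    segment (pos a) (pos b) (pos w) -> w = a \/ w = b;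
  drawn_cross : forall a b c d p, D a b -> D c d -> (a, b) <> (c, d) ->
    segment (pos a) (pos b) p -> segment (pos c) (pos d) p ->
    exists w, [/\ w = a \/ w = b, w = c \/ w = d & p = pos w];
  drawn_face : forall a b, D a b ->
    exists f, [/\ Fs f, corner f (pos a) & corner f (pos b)];
  drawn_pos : forall f, Fs f -> positive f;
  drawn_free_vertex : forall f w, Fs f -> w \in V -> ~ inside f (pos w);
  drawn_free_edge : forall f a b p, Fs f -> D a b ->
    segment (pos a) (pos b) p -> ~ inside f p;
  drawn_disjoint : forall f g p, Fs f -> Fs g -> inside f p -> inside g p ->
    f = g }.

Definition stack_edge D v N x y := D x y \/ (x = v /\ y \in N).
Definition stack_pos pos v p x := if x == v then p else pos x.
Definition stack_face Fs f g := (Fs g /\ g <> f) \/ subface f g.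

(** The new edges are spokes of [f]. Apart from its far end a spoke runs inside [f], where nothing
    was drawn. A corner of [f] may carry no vertex. *)
Lemma stack V D pos Fs f v N : drawn V D pos Fs -> Fs f -> v \notin V ->
  N \subset V -> (forall x, x \in N -> corner f (pos x)) ->
  drawn (v |: V) (stack_edge D v N) (stack_pos pos v (centroid f)) (stack_face Fs f).
Proof.
move=> [inj edg ver cro fac fpos fver fedg dis] Ff vV NV cN.
have pf := fpos _ Ff; have inc := inside_centroid pf.
set pos' := stack_pos _ _ _.
have pv : pos' v = centroid f by rewrite /pos' /stack_pos eqxx.
have pV x : x \in V -> pos' x = pos x.
  by rewrite /pos' /stack_pos; case: eqP => // -> xV; rewrite xV in vV.
have pD a b : D a b -> pos' a = pos a /\ pos' b = pos b.
  by move=> /edg[aV bV _]; rewrite !pV.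
have NV' x : x \in N -> x \in V by move/(fintype.subsetP NV).
have pN x : x \in N -> pos' x = pos x by move/NV'/pV.
have Nv x : x \in N -> x <> v by move=> /NV' xV e; rewrite -e xV in vV.
have onew a b x p : D a b -> segment (pos a) (pos b) p -> x \in N ->
    segment (centroid f) (pos x) p -> p = pos x /\ (x = a \/ x = b).
  move=> Dab sp xN sq.
  have [e|/(fedg _ _ _ _ Ff Dab sp)//] := spoke pf (cN _ xN) sq.
  by split=> //; apply: (ver a b) => //; [exact: NV'|rewrite -e].
split.
- move=> x y; rewrite !finset.in_setU1.
  have cV z : z \in V -> centroid f = pos' z -> False.
    by move=> zV; rewrite pV // => e; apply: (fver f z) => //; rewrite -e.
  move=> /orP[/eqP->|xV] /orP[/eqP->|yV] //; rewrite ?pv.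
  + by move/(cV _ yV).
  + by move/esym/(cV _ xV).
  + by rewrite !pV //; apply: inj.
- move=> a b [/edg[aV bV ab]|[-> bN]]; rewrite !finset.in_setU1.
    by rewrite aV bV !orbT.
  by rewrite eqxx (NV' _ bN) orbT; split=> // e; apply: (Nv b).
- move=> a b w [Dab|[-> bN]]; rewrite finset.in_setU1.
    have [-> ->] := pD _ _ Dab; move=> /orP[/eqP->|wV].
      by rewrite pv => sp; case: (fedg _ _ _ _ Ff Dab sp).
    by rewrite pV //; apply: ver.
  move=> /orP[/eqP->|wV]; first by left.
  rewrite pv (pN _ bN) (pV w) // => sp.
  have [e|i] := spoke pf (cN _ bN) sp; last by case: (fver f w).
  by right; apply: inj => //; exact: NV'.
- move=> a b c d p [Dab|[-> bN]] [Dcd|[-> dN]] ne.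
  + have [-> ->] := pD _ _ Dab; have [-> ->] := pD _ _ Dcd => s1 s2.
    have [w [h1 h2 h3]] := cro _ _ _ _ _ Dab Dcd ne s1 s2.
    exists w; split=> //; rewrite pV //; have [aV bV _] := edg _ _ Dab.
    by case: h1 => ->.
  + have [-> ->] := pD _ _ Dab; rewrite pv (pN _ dN) => s1 s2.
    by have [e h] := onew _ _ _ _ Dab s1 dN s2; exists d; rewrite pN //; split=> //; right.
  + have [-> ->] := pD _ _ Dcd; rewrite pv (pN _ bN) => s1 s2.
    by have [e h] := onew _ _ _ _ Dcd s2 bN s1; exists b; rewrite pN //; split=> //; right.
  + rewrite pv !pN // => s1 s2; exists v; split; rewrite ?pv; try by left.
    apply: (spokes_meet pf (cN _ bN) (cN _ dN)) => // e; apply: ne.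
    by congr pair; apply: inj => //; exact: NV'.
- move=> a b [Dab|[-> bN]].
    have [-> ->] := pD _ _ Dab; have [g [Fg ga gb]] := fac _ _ Dab.
    have [gf|gf] := pselect (g = f); last by exists g; split=> //; left.
    rewrite gf in ga gb; have [h [sh ha hb]] := subface_corners ga gb.
    by exists h; split=> //; right.
  rewrite pv pN //; have [h [sh hb _]] := subface_corners (cN _ bN) (cN _ bN).
  by exists h; split=> //; [right|exact: subface_centroid].
- by move=> g [[/fpos]|/(subface_positive pf)].
- move=> g w Fg; rewrite finset.in_setU1 => /orP[/eqP->|wV]; rewrite ?pv ?pV //.
    case: Fg => [[Fg ne] ig|sg]; first by apply: ne; apply: dis ig inc.
    (* The centroid is the point [t = 0] of a spoke, and spokes avoid the interior of every
       subface. *)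
    have sA : segment (centroid f) (tA f) (centroid f).
      exists 0; first by rewrite lexx ler01.
      by rewrite /segpt !mul0r !addr0 -surjective_pairing.
    by apply: (spoke_subface pf _ sA sg); constructor 1.
  by case: Fg => [[Fg _]|sg /(subface_inside sg)]; apply: fver.
- move=> g a b p Fg [Dab|[-> bN]].
    have [-> ->] := pD _ _ Dab => sp.
    by case: Fg => [[Fg _]|sg /(subface_inside sg)]; apply: fedg sp.
  rewrite pv pN // => sp; case: Fg => [[Fg ne] ig|sg]; last exact: (spoke_subface pf (cN _ bN) sp sg).
  have [e|i] := spoke pf (cN _ bN) sp; last by apply: ne; apply: dis ig i.
  by apply: (fver g b) => //; [exact: NV'|rewrite -e].
- move=> g h p [[Fg ng]|sg] [[Fh nh]|sh] ig ih.
  + exact: dis ig ih.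
  + by case: ng; apply: dis ig (subface_inside sh ih).
  + by case: nh; apply: dis ih (subface_inside sg ig).
  + exact: (subface_eq sg sh ig ih).
Qed.

Definition drawable V (F : rel L) : Prop := exists D pos Fs,
  drawn V D pos Fs /\ forall x y, F x y -> D x y \/ D y x.

(** A glued K4 adds two vertices: [v] at the centroid of a face at [a b], then [w] in a subface that
    still has [a] and [b] as corners and has gained [v]. *)
Lemma ext_drawable V0 F0 V F : drawable V0 F0 -> ext V0 F0 V F -> drawable V F.
Proof.
move=> d0; elim=> {V F}[//|V F a b W _ [D [pos [Fs [dr cov]]]] aV bV Fab dWV cW|]; last first.
  by move=> V F F' _ [D [pos [Fs [dr cov]]]] sF; exists D, pos, Fs; split=> // x y /sF/cov.
have [f [Ff fa fb]] : exists f, [/\ Fs f, corner f (pos a) & corner f (pos b)].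
  case: (cov _ _ Fab) => Dab; first exact: drawn_face dr _ _ Dab.
  by have [f [? ? ?]] := drawn_face dr Dab; exists f.
have cN x : x \in [set a; b]%SET -> corner f (pos x).
  by rewrite !finset.inE => /orP[]/eqP->.
have NV : [set a; b]%SET \subset V by rewrite finset.subUset !finset.sub1set aV.
have posE v p x : x \in V -> v \notin V -> stack_pos pos v p x = pos x.
  by rewrite /stack_pos; case: eqP => // -> ->.
have [W0|[v eW]|[v [w [vw eW]]]] : [\/ W = finset.set0, exists v, W = [set v]%SET |
    exists v w, v != w /\ W = [set v; w]%SET].
  have : [|| #|W| == 0, #|W| == 1 | #|W| == 2]%N by lia.
  case/or3P=> [|/cards1P[v ->]|/cards2P[v [w [vw ->]]]].
  - by rewrite cards_eq0 => /eqP; constructor 1.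
  - by constructor 2; exists v.
  - by constructor 3; exists v, w.
- exists D, pos, Fs; rewrite W0 finset.setU0; split=> // x y /orP[/cov//|].
  rewrite /clique !finset.inE !orbF => /and3P[/orP[]/eqP-> /orP[]/eqP->]; rewrite ?eqxx //.
    by move=> _; apply: cov.
  by move=> _; case: (cov _ _ Fab); [right|left].
- have vV : v \notin V by rewrite (disjointFr dWV) // eW finset.inE.
  have dr' := stack dr Ff vV NV cN.
  exists (stack_edge D v [set a; b]%SET), (stack_pos pos v (centroid f)), (stack_face Fs f).
  split; first by rewrite eW finset.setUC.
  move=> x y /orP[/cov[]|]; [by left; left|by right; left|].
  have Nab z : z \in [set a; b]%SET -> stack_edge D v [set a; b]%SET v z by right.
  have [na nb] : a \in [set a; b]%SET /\ b \in [set a; b]%SET.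
    by rewrite !finset.inE !eqxx orbT.
  rewrite eW /clique !finset.inE.
  case/and3P=> /or3P[]/eqP-> /or3P[]/eqP->; rewrite ?eqxx // => _;
    try (by left; apply: Nab); try (by right; apply: Nab).
    by case: (cov _ _ Fab); [left; left|right; left].
  by case: (cov _ _ Fab); [right; left|left; left].
have vV : v \notin V by rewrite (disjointFr dWV) // eW !finset.inE eqxx.
have wV : w \notin V by rewrite (disjointFr dWV) // eW !finset.inE eqxx orbT.
have dr1 := stack dr Ff vV NV cN.
set D1 := stack_edge _ _ _ in dr1; set pos1 := stack_pos _ _ _ in dr1.
have [g [sg ga gb]] := subface_corners fa fb.
have Fg : stack_face Fs f g by right.
have wV1 : w \notin (v |: V)%SET by rewrite finset.inE finset.inE negb_or eq_sym vw.
have NV1 : [set a; b; v]%SET \subset (v |: V)%SET.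
  by apply/fintype.subsetP => x; rewrite !finset.inE => /orP[/orP[]|]/eqP->; rewrite ?aV ?bV ?eqxx ?orbT.
have cN1 x : x \in [set a; b; v]%SET -> corner g (pos1 x).
  rewrite !finset.inE => /orP[/orP[]|]/eqP->; rewrite /pos1 ?(posE _ _ _ aV vV) ?(posE _ _ _ bV vV) //.
  by rewrite /stack_pos eqxx; apply: subface_centroid.
have dr2 := stack dr1 Fg wV1 NV1 cN1.
exists (stack_edge D1 w [set a; b; v]%SET), (stack_pos pos1 w (centroid g)),
  (stack_face (stack_face Fs f) g).
split; first by rewrite eW finset.setUC -finset.setUA finset.setUCA.
have Nab z : z \in [set a; b]%SET -> stack_edge D1 w [set a; b; v]%SET v z by left; right.
have [na nb] : a \in [set a; b]%SET /\ b \in [set a; b]%SET.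
  by rewrite !finset.inE !eqxx orbT.
have Nabv z : z \in [set a; b; v]%SET -> stack_edge D1 w [set a; b; v]%SET w z by right.
have [ma mb mv] : [/\ a \in [set a; b; v]%SET, b \in [set a; b; v]%SET & v \in [set a; b; v]%SET].
  by rewrite !finset.inE !eqxx !orbT.
move=> x y /orP[/cov[]|]; [by left; left; left|by right; left; left|].
rewrite eW /clique !finset.inE.
case/and3P=> /or4P[]/eqP-> /or4P[]/eqP->; rewrite ?eqxx // => _;
  try (by left; apply: Nabv); try (by right; apply: Nabv);
  try (by left; apply: Nab); try (by right; apply: Nab).
  by case: (cov _ _ Fab); [left; left; left|right; left; left].
by case: (cov _ _ Fab); [right; left; left|left; left; left].
Qed.

Lemma edge_drawable (a b : L) : a != b -> drawable [set a; b]%SET (clique [set a; b]%SET).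
Proof.
move=> ab; pose pos x : R * R := if x == a then (0, 0) else (1, 0).
have pa : pos a = (0, 0) by rewrite /pos eqxx.
have pb : pos b = (1, 0) by rewrite /pos eq_sym (negPf ab).
have onbase p : segment (0, 0) (1, 0) p -> p.2 = 0.
  by case=> t _ ->; rewrite /segpt /=; ring.
(* The third corner carries no vertex; it only provides an empty triangle on the edge. *)
pose f := Triangle (0, 0) (1, 0) (0, 1).
have base p : inside f p -> p.2 <> 0.
  by case=> h _ _ e; move: h; rewrite /orient /= e; lra.
exists (fun x y => x = a /\ y = b), pos, (eq f); split; last first.
  move=> x y; rewrite /clique !finset.inE.
  by case/and3P=> /orP[]/eqP-> /orP[]/eqP->; rewrite ?eqxx // => _; [left|right].
split.
- move=> x y; rewrite !finset.inE => /orP[]/eqP-> /orP[]/eqP->; rewrite ?pa ?pb // => -[/eqP].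
    by rewrite eq_sym oner_eq0.
  by rewrite oner_eq0.
- by move=> x y [-> ->]; rewrite !finset.inE !eqxx orbT; split=> //; apply/eqP.
- by move=> x y w [-> ->]; rewrite !finset.inE => /orP[]/eqP-> _; [left|right].
- by move=> x y z w p [-> ->] [-> ->].
- by move=> x y [-> ->]; exists f; rewrite pa pb; split=> //; [constructor 1|constructor 2].
- by move=> _ <-; rewrite /positive /orient /=; lra.
- move=> _ w <-; rewrite !finset.inE => /orP[]/eqP->; rewrite ?pa ?pb; by move/base.
- by move=> _ x y p <- [-> ->]; rewrite pa pb => /onbase e /base.
- by move=> _ _ p <- <-.
Qed.

End Drawing.

Local Open Scope classical_set_scope.

Lemma segment_arc p q : p <> q -> arc_between p q (segment p q).
Proof.
move=> pq; exists (segpt p q); split.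
- apply: continuous_subspaceT => t; rewrite /segpt.
  have aff (u v : R) : (u + x * v) @[x --> t] --> u + t * v.
    apply: cvgD; first exact: cvg_cst.
    by apply: cvgM; [exact: cvg_id|exact: cvg_cst].
  exact: (cvg_pair (aff _ _) (aff _ _)).
- move=> s t _ _ [/addrI e1 /addrI e2]; apply/eqP; rewrite -subr_eq0; apply/eqP.
  have {}e1 : (s - t) * (q.1 - p.1) = 0 by lra.
  have {}e2 : (s - t) * (q.2 - p.2) = 0 by lra.
  apply/eqP/negP => /negP st; apply: pq.
  move/eqP: e1; rewrite mulf_eq0 (negPf st) /= subr_eq0 => /eqP e1.
  move/eqP: e2; rewrite mulf_eq0 (negPf st) /= subr_eq0 => /eqP e2.
  by rewrite [p]surjective_pairing -e1 -e2 -surjective_pairing.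
- by rewrite /segpt !mul0r !addr0 -surjective_pairing.
- by apply: injective_projections => /=; ring.
- apply/seteqP; split=> x.
    by case=> t t01 ->; exists t => //=; rewrite in_itv.
  by case=> t /=; rewrite in_itv /= => t01 <-; exists t.
Qed.

Lemma drawable_planar (H : sgraph) (F : rel H) : drawable [set: H]%SET F ->
  (forall x y, adj x y -> F x y) -> planar R H.
Proof.
move=> [D [pos [Fs [dr cov]]]] sub.
have T x : x \in [set: H]%SET by rewrite finset.in_setT.
have edgeP E : E \in edges H -> exists u v, E = [set u; v]%SET /\ D u v.
  rewrite finset.inE => /existsP[u /existsP[v /andP[uv /eqP->]]].
  case: (cov _ _ (sub _ _ uv)) => h; first by exists u, v.
  by exists v, u; rewrite finset.setUC.
(* The ends are ordered as [D] records them, while an edge of [H] is an unordered pair. *)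
pose arc (E : {set H}) p := exists u v, [/\ E = [set u; v]%SET, D u v & segment (pos u) (pos v) p].
exists pos, arc; split.
- by move=> x y; apply: drawn_inj dr _ _ _ _.
- move=> u v uv.
  have nuv : u <> v by move=> e; rewrite e adj_irr in uv.
  have -> : arc [set u; v]%SET = segment (pos u) (pos v).
    apply/seteqP; split=> p.
      case=> x [y [/finset.setP e Dxy s]].
      have [_ _ nxy] := drawn_edge dr Dxy.
      have := e x; have := e y; rewrite !finset.inE !eqxx !orbT.
      move=> /orP[]/eqP ey /orP[]/eqP ex; subst x y => //; exact: segmentC.
    move=> s; case: (cov _ _ (sub _ _ uv)) => h; first by exists u, v.
    by exists v, u; split=> //; [rewrite finset.setUC|exact: segmentC].
  by apply: segment_arc => /(drawn_inj dr (T _) (T _)).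
- move=> E w EH [u [v [-> Duv s]]].
  by case: (drawn_vertex dr Duv (T w) s) => ->; rewrite !finset.inE eqxx ?orbT.
- move=> E F' _ _ ne p [u [v [eE Duv s]]] [x [y [eF Dxy s']]].
  have ne' : (u, v) <> (x, y) by move=> [e1 e2]; apply: ne; rewrite eE eF e1 e2.
  have [w [h1 h2 ->]] := drawn_cross dr Duv Dxy ne' s s'.
  exists w => //; rewrite eE eF !finset.inE.
  by apply/andP; split; [case: h1|case: h2] => ->; rewrite eqxx ?orbT.
Qed.

End Geometry.

Lemma ends_graph_planar (R : realType) (G T : sgraph) (S : G -> {set T}) :
  connected_graph G -> 4 <= #|G| -> orth_representation 3 2 3 S ->
  planar R (ends_graph S).
Proof.
move=> Gconn Gord orth.
have [F [z [d [[_ vF eF] Fzd sub]]]] := ends_graph_good Gconn Gord orth.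
have [_ _ zd] := vF _ _ Fzd.
apply: (@drawable_planar R (ends_graph S) F); last exact: sub.
exact: ext_drawable (edge_drawable R zd) (eF _ _ Fzd).
Qed.

Theorem theorem6 (R : realType) (G : sgraph) (Gconn : connected_graph G)
    (Gtwf : twin_free G) (Gord : 4 <= #|G|) (Gorth : ORTH 3 2 3 G) :
  exists H : sgraph, planar R H /\ isomorphic G (line_graph H).
Proof.
have [T [S orth]] := Gorth.
exists (ends_graph S); split; first exact: ends_graph_planar Gconn Gord orth.
exact: isomorphic_line_ends_graph Gconn Gtwf Gord orth.
Qed.
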